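(* Let $p$ be an odd prime number and $n\ge 1$ an integer. Let $F$ be any field with $\operatorname{char}(F)\ne p$, and let $M=F(\mu_{p^n})$. Let $\alpha:\mathrm{Gal}(M/F)\to(\mathbb Z/p^n\mathbb Z)^*$ be the cyclotomic character. Then there is a one-to-one correspondence between the subgroups $U$ of $F^*/F^{*p^n}$ and the abelian Galois extensions $K$ of $M$ such that the exponent of $\mathrm{Gal}(K/M)$ divides $p^n$, $K$ is Galois over $F$, and $\mathrm{Gal}(M/F)$ acts on $\mathrm{Gal}(K/M)$ via $\alpha$.
   Context: All fields lie in a fixed algebraic closure of $F$. $\mu_{p^n}$ is the group of $p^n$-th roots of unity there. The cyclotomic character $\alpha$ is defined by $g(\omega)=\omega^{\alpha(g)}$ for all $g\in \mathrm{Gal}(M/F)$, $\omega\in\mu_{p^n}$. Extensions may be of infinite degree. If $K\supseteq M$ is Galois over $F$ with $\mathrm{Gal}(K/M)$ abelian, then $\mathrm{Gal}(M/F)$ acts on $\mathrm{Gal}(K/M)$ by $\bar\tau\cdot\sigma=\tau\sigma\tau^{-1}$, where $\tau\in\mathrm{Gal}(K/F)$ is any element restricting to $\bar\tau\in\mathrm{Gal}(M/F)$. ''Acts via $\alpha$'' means $g\cdot\sigma=\sigma^{\alpha(g)}$ for all $g\in \mathrm{Gal}(M/F)$, $\sigma\in \mathrm{Gal}(K/M)$. *)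

(* Defs.v *)
From HB Require Import structures.
From mathcomp Require Import all_boot all_order all_algebra all_field.
From mathcomp Require Import boolp classical_sets functions.

Set Implicit Arguments.
Unset Strict Implicit.
Unset Printing Implicit Defensive.

Import GRing.Theory.
Local Open Scope ring_scope.
Local Open Scope quotient_scope.

Record mulgrp (F : fieldType) := Mulgrp {
  mulgrp_val :> F;
  _ : mulgrp_val != 0
}.

Section MulGroup.
Variable F : fieldType.

HB.instance Definition _ := [isSub for @mulgrp_val F].
HB.instance Definition _ := [Choice of mulgrp F by <:].

Implicit Types u v : mulgrp F.

Definition mulgrp1 : mulgrp F := Sub 1 (oner_neq0 F).
Lemma mulgrpM_subproof u v : val u * val v != 0.
Proof. exact: mulf_neq0 (valP u) (valP v). Qed.
Definition mulgrpM u v : mulgrp F := Sub (val u * val v) (mulgrpM_subproof u v).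
Lemma mulgrpV_subproof u : (val u)^-1 != 0.
Proof. by rewrite invr_eq0 (valP u). Qed.
Definition mulgrpV u : mulgrp F := Sub (val u)^-1 (mulgrpV_subproof u).

Lemma mulgrpA : associative mulgrpM.
Proof. by move=> u v w; apply: val_inj; rewrite /= mulrA. Qed.
Lemma mulgrp1g : left_id mulgrp1 mulgrpM.
Proof. by move=> u; apply: val_inj; rewrite /= mul1r. Qed.
Lemma mulgrpg1 : right_id mulgrp1 mulgrpM.
Proof. by move=> u; apply: val_inj; rewrite /= mulr1. Qed.
Lemma mulgrpVg : left_inverse mulgrp1 mulgrpV mulgrpM.
Proof. by move=> u; apply: val_inj; rewrite /= mulVf // (valP u). Qed.
Lemma mulgrpgV : right_inverse mulgrp1 mulgrpV mulgrpM.
Proof. by move=> u; apply: val_inj; rewrite /= mulfV // (valP u). Qed.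

HB.instance Definition _ := isGroup.Build (mulgrp F)
  mulgrpA mulgrp1g mulgrpg1 mulgrpVg mulgrpgV.

Lemma mulgrpC u v : (u * v = v * u)%g.
Proof. by apply: val_inj; rewrite /= mulrC. Qed.

End MulGroup.

Section PowerClasses.
Variables (F : fieldType) (m : nat).
Implicit Types u v w : mulgrp F.

Definition eqpow u v := `[< exists w, u = v * w ^+ m >]%g.

Lemma eqpowP u v : reflect (exists w, u = v * w ^+ m)%g (eqpow u v).
Proof. exact: asboolP. Qed.

Lemma eqpow_is_equiv : equiv_class_of eqpow.
Proof.
have sym u v : eqpow u v -> eqpow v u.
  move=> /eqpowP[w ->]; apply/eqpowP; exists w^-1%g.
  by rewrite expVgn mulgK.
split=> [u | u v | v u w /eqpowP[a ->] /eqpowP[b ->]].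
- by apply/eqpowP; exists 1%g; rewrite expg1n mulg1.
- by apply/idP/idP; apply: sym.
apply/eqpowP; exists (b * a)%g.
by rewrite expgMn ?mulgA //; apply: mulgrpC.
Qed.

Canonical eqpow_equiv := EquivRelPack eqpow_is_equiv.
Canonical eqpow_encModRel := defaultEncModRel eqpow.

Definition powquot := {eq_quot eqpow}.
HB.instance Definition _ := Choice.on powquot.
HB.instance Definition _ := EqQuotient.on powquot.

Definition powclass u : powquot := \pi_powquot u.

Implicit Types x y z : powquot.

Definition powquot1 : powquot := powclass 1%g.
Definition powquotM x y : powquot := powclass (repr x * repr y)%g.
Definition powquotV x : powquot := powclass (repr x)^-1%g.

Lemma powclassP u v : reflect (exists w, u = v * w ^+ m)%g (powclass u == powclass v).
Proof. by rewrite eqmodE; apply: eqpowP. Qed.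

Lemma repr_powclass u : exists w, (repr (powclass u) = u * w ^+ m)%g.
Proof. by apply/powclassP; rewrite /powclass reprK. Qed.

Lemma powquotME u v : powquotM (powclass u) (powclass v) = powclass (u * v)%g.
Proof.
have [[a ea] [b eb]] := (repr_powclass u, repr_powclass v).
apply/eqP/powclassP; exists (a * b)%g; rewrite ea eb expgMn; last exact: mulgrpC.
by rewrite -!mulgA; congr (_ * _)%g; rewrite mulgA (mulgrpC _ v) -mulgA.
Qed.

Lemma powquotVE u : powquotV (powclass u) = powclass u^-1%g.
Proof.
have [a ea] := repr_powclass u.
by apply/eqP/powclassP; exists a^-1%g; rewrite ea invgM expVgn mulgrpC.
Qed.

Lemma powclass_surj x : exists u, x = powclass u.
Proof. by exists (repr x); rewrite /powclass reprK. Qed.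

Lemma powquotA : associative powquotM.
Proof.
move=> x y z; have [u ->] := powclass_surj x; have [v ->] := powclass_surj y.
by have [w ->] := powclass_surj z; rewrite !powquotME mulgA.
Qed.
Lemma powquot1g : left_id powquot1 powquotM.
Proof. by move=> x; have [u ->] := powclass_surj x; rewrite powquotME mul1g. Qed.
Lemma powquotg1 : right_id powquot1 powquotM.
Proof. by move=> x; have [u ->] := powclass_surj x; rewrite powquotME mulg1. Qed.
Lemma powquotVg : left_inverse powquot1 powquotV powquotM.
Proof.
by move=> x; have [u ->] := powclass_surj x; rewrite powquotVE powquotME mulVg.
Qed.
Lemma powquotgV : right_inverse powquot1 powquotV powquotM.
Proof.
by move=> x; have [u ->] := powclass_surj x; rewrite powquotVE powquotME mulgV.
Qed.

HB.instance Definition _ := isGroup.Build powquot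
  powquotA powquot1g powquotg1 powquotVg powquotgV.

End PowerClasses.

(* The membership predicate is boolean and the closure condition a Prop, so
   that two subfields are equal as soon as they have the same elements. *)
Record subfield (L : fieldType) := Subfield {
  subfield_fun : L -> bool;
  subfield_closed : divring_closed subfield_fun
}.

Coercion subfield_pred (L : fieldType) (K : subfield L) : {pred L} :=
  subfield_fun K.

Section Subfields.
Variable L : fieldType.

HB.instance Definition _ (K : subfield L) :=
  GRing.isDivringClosed.Build L (subfield_pred K) (subfield_closed K).

Lemma subfield_eqP (K1 K2 : subfield L) : K1 =i K2 -> K1 = K2.
Proof.
case: K1 K2 => [K1 h1] [K2 h2] /= e.
have {}e : K1 = K2 by apply: funext => x; exact: (e x).
by case: _ / e h2 => h2; rewrite (Prop_irrelevance h1 h2).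
Qed.

Record subfield_sort (K : subfield L) := SubfieldElt {
  subfield_val : L;
  _ : subfield_val \in subfield_pred K
}.
HB.instance Definition _ (K : subfield L) := [isSub for @subfield_val K].
HB.instance Definition _ (K : subfield L) := [Choice of subfield_sort K by <:].
HB.instance Definition _ (K : subfield L) :=
  [SubChoice_isSubIntegralDomain of subfield_sort K by <:].
HB.instance Definition _ (K : subfield L) :=
  [SubIntegralDomain_isSubField of subfield_sort K by <:].

Coercion subfield_sort : subfield >-> Sortclass.

Lemma subfield_gen_closed (A : set L) :
  divring_closed (fun x : L =>
    `[< forall K : subfield L, (forall a, A a -> a \in K) -> x \in K >]).
Proof.
split; first by apply/asboolP => K _; apply: rpred1.
  move=> x y /asboolP hx /asboolP hy; apply/asboolP => K AK.
  by apply: rpredB; [apply: hx | apply: hy].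
move=> x y /asboolP hx /asboolP hy; apply/asboolP => K AK.
by apply: rpred_div; [apply: hx | apply: hy].
Qed.

Definition subfield_gen (A : set L) : subfield L :=
  Subfield (subfield_gen_closed A).

Section Image.
Variables (F : fieldType) (iota : {rmorphism F -> L}).

Lemma subfield_image_closed :
  divring_closed (fun x : L => `[< exists a, iota a = x >]).
Proof.
split; first by apply/asboolP; exists 1; rewrite rmorph1.
  by move=> _ _ /asboolP[a <-] /asboolP[b <-]; apply/asboolP; exists (a - b);
     rewrite rmorphB.
by move=> _ _ /asboolP[a <-] /asboolP[b <-]; apply/asboolP; exists (a / b);
   rewrite fmorph_div.
Qed.

Definition subfield_image : subfield L := Subfield subfield_image_closed.

(* F(mu_m), F being identified with its image in L. *)
Definition cyclotomic_subfield (m : nat) : subfield L :=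
  subfield_gen (range iota `|` [set w : L | w ^+ m = 1])%classic.

End Image.
End Subfields.

Record aut (K : fieldType) := Aut {
  aut_fun :> K -> K;
  aut_zmod : zmod_morphism aut_fun;
  aut_monoid : monoid_morphism aut_fun;
  aut_bij : bijective aut_fun
}.

HB.instance Definition _ (K : fieldType) := gen_eqMixin (aut K).
HB.instance Definition _ (K : fieldType) := gen_choiceMixin (aut K).

Section AutGroup.
Variable K : fieldType.
Implicit Types s t : aut K.

HB.instance Definition _ s :=
  GRing.isZmodMorphism.Build K K (aut_fun s) (aut_zmod s).
HB.instance Definition _ s :=
  GRing.isMonoidMorphism.Build K K (aut_fun s) (aut_monoid s).

Lemma aut_eqP s t : s =1 t -> s = t.
Proof.
case: s t => [s s1 s2 s3] [t t1 t2 t3] /= /funext e.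
case: _ / e t1 t2 t3 => t1 t2 t3.
by rewrite (Prop_irrelevance s1 t1) (Prop_irrelevance s2 t2)
           (Prop_irrelevance s3 t3).
Qed.

Definition aut1 : aut K :=
  @Aut K idfun (fun _ _ => erefl) (erefl, fun _ _ => erefl)
    (Bijective (frefl _) (frefl _)).

Lemma autM_zmod s t : zmod_morphism (s \o t).
Proof. by move=> x y /=; rewrite !rmorphB. Qed.
Lemma autM_monoid s t : monoid_morphism (s \o t).
Proof. by split=> [|x y] /=; rewrite ?rmorph1 ?rmorphM. Qed.
Definition autM s t : aut K :=
  Aut (autM_zmod s t) (autM_monoid s t) (bij_comp (aut_bij s) (aut_bij t)).

Lemma aut_inv_ex s : exists g, cancel s g /\ cancel g s.
Proof. by case: (aut_bij s) => g sK gK; exists g. Qed.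
Definition aut_inv s := projT1 (cid (aut_inv_ex s)).
Lemma aut_invK s : cancel s (aut_inv s) /\ cancel (aut_inv s) s.
Proof. exact: projT2 (cid (aut_inv_ex s)). Qed.

Lemma autV_zmod s : zmod_morphism (aut_inv s).
Proof.
have [sK Ks] := aut_invK s.
by move=> x y; apply: (can_inj sK); rewrite rmorphB /= !Ks.
Qed.
Lemma autV_monoid s : monoid_morphism (aut_inv s).
Proof.
have [sK Ks] := aut_invK s.
by split=> [|x y]; apply: (can_inj sK); rewrite Ks ?rmorph1 ?rmorphM /= ?Ks.
Qed.
Lemma autV_bij s : bijective (aut_inv s).
Proof. by have [sK Ks] := aut_invK s; exists s. Qed.
Definition autV s : aut K := Aut (autV_zmod s) (autV_monoid s) (autV_bij s).

Lemma autA : associative autM. Proof. by move=> s t u; apply: aut_eqP. Qed.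
Lemma aut1g : left_id aut1 autM. Proof. by move=> s; apply: aut_eqP. Qed.
Lemma autg1 : right_id aut1 autM. Proof. by move=> s; apply: aut_eqP. Qed.
Lemma autVg : left_inverse aut1 autV autM.
Proof. by move=> s; apply: aut_eqP => x; have [sK Ks] := aut_invK s; rewrite /= ?sK ?Ks. Qed.
Lemma autgV : right_inverse aut1 autV autM.
Proof. by move=> s; apply: aut_eqP => x; have [sK Ks] := aut_invK s; rewrite /= ?sK ?Ks. Qed.

HB.instance Definition _ := isGroup.Build (aut K) autA aut1g autg1 autVg autgV.

End AutGroup.

Section GaloisGroup.
Variables (L : fieldType) (K k : subfield L).

Definition fixes : {pred aut K} :=
  fun s => `[< forall x : K, val x \in k -> s x = x >].

Lemma fixes_closed : group_closed fixes.
Proof.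
split; first by apply/asboolP.
move=> s t /asboolP hs /asboolP ht; apply/asboolP => x kx.
have {}ht : (t^-1)%g x = x.
  by rewrite -{1}(ht x kx) -[LHS]/((t^-1 * t)%g x) mulVg.
by rewrite -[LHS]/(s ((t^-1)%g x)) ht hs.
Qed.

Record galgrp := GalElt { galgrp_val :> aut K; _ : galgrp_val \in fixes }.
HB.instance Definition _ := [isSub for galgrp_val].
HB.instance Definition _ := [Choice of galgrp by <:].
HB.instance Definition _ :=
  SubChoice_isSubGroup.Build (aut K) fixes galgrp fixes_closed.

End GaloisGroup.

(* K / k is Galois, i.e. algebraic, separable and normal, possibly of infinite
   degree. *)
Definition galois_ext (L : fieldType) (K k : subfield L) : Prop :=
  [/\ {subset k <= K},
      forall x : L, x \in K -> algebraicOver (\val : k -> L) x,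
      forall p : {poly k}, irreducible_poly p ->
        (exists2 x : L, x \in K & root (map_poly \val p) x) ->
        separable_poly p
    & forall p : {poly k}, irreducible_poly p ->
        (exists2 x : L, x \in K & root (map_poly \val p) x) ->
        exists2 rs : seq L, {subset rs <= K}
          & map_poly \val p %= \prod_(r <- rs) ('X - r%:P)].

Definition is_abelian (G : groupType) : Prop := forall s t : G, commute s t.

Definition is_exponent (G : groupType) (e : nat) : Prop :=
  [/\ (0 < e)%N, forall s : G, (s ^+ e = 1)%g
    & forall d : nat, (0 < d)%N -> (forall s : G, (s ^+ d = 1)%g) -> (e <= d)%N].

Definition exponent_dvd (G : groupType) (m : nat) : Prop :=
  exists2 e : nat, is_exponent G e & (e %| m)%N.

(* For m > 1 only: 'Z_m is the ring of integers modulo maxn m 2. *)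
Definition is_cyclotomic_character (L : fieldType) (M k : subfield L) (m : nat)
    (alpha : galgrp M k -> {unit 'Z_m}) : Prop :=
  forall (g : galgrp M k) (w : M), w ^+ m = 1 -> val g w = w ^+ val (alpha g).

Definition restricts_to (L : fieldType) (K M k : subfield L)
    (t : galgrp K k) (g : galgrp M k) : Prop :=
  forall (x : K) (y : M), val x = val y -> val (val t x) = val (val g y).

(* The exponent alpha g is represented by a natural number below m, which is
   harmless when the exponent of Gal(K / M) divides m. *)
Definition acts_via (L : fieldType) (K M k : subfield L) (m : nat)
    (alpha : galgrp M k -> {unit 'Z_m}) : Prop :=
  forall (g : galgrp M k) (s : galgrp K M) (t : galgrp K k), restricts_to t g ->
    (val t * val s * (val t)^-1 = val s ^+ val (alpha g))%g.

(* Main.v *)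
(* Write q = p^n and G = Gal(M/F). The subgroup U corresponds to the field K
   generated over M by the q-th roots of the elements of U.

   By Kummer theory, an extension of M which is abelian of exponent dividing q is
   generated by elements b with b^q in M. If K is moreover Galois over F and G acts
   on Gal(K/M) via the cyclotomic character, then the quotients t(b)/b are fixed by
   Gal(K/M), hence lie in M. It remains to see that F*/F*^q is the group of
   G-invariants of M*/M*^q: by Hilbert 90 the kernel and the cokernel of the map are
   controlled by H^1(G, mu_q) and by H^2(G, mu_q). As p is odd, G is cyclic,
   generated by the class of some u in (Z/q)*, and both groups vanish because the
   sum of the powers of u over a period and u - 1 have complementary p-adic
   valuations.

   Automorphisms are taken in Aut(L/k), for L the algebraic closure; a field K is
   Galois over k when it is stable under Aut(L/k) and the elements of K fixed by
   that group are those of k. *)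

From mathcomp Require Import all_fingroup all_solvable.
Require Import Defs.
From HB Require Import structures.
From mathcomp Require Import all_boot all_order all_algebra all_field.
From mathcomp Require Import boolp classical_sets functions.
From mathcomp Require Import ring.

Set Implicit Arguments.
Unset Strict Implicit.
Unset Printing Implicit Defensive.

Import GRing.Theory.
Local Open Scope ring_scope.

(** * Extension of embeddings into an algebraic closure *)

Section AlgebraicOverF.
Variables (F : fieldType) (L : fieldType) (iota : {rmorphism F -> L}).
Hypothesis L_alg : forall x : L, algebraicOver iota x.

(** Dividing by X lowers the degree until the constant term c is nonzero; then x q(x) = -c exhibits
    the inverse of x as a polynomial in x. *)
Lemma algebraic_inv_poly (x : L) : x != 0 ->
  exists g : {poly F}, x * (map_poly iota g).[x] = 1.
Proof.
move=> x0; have [p p0 px] := L_alg x.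
have [n] := ubnP (size p); elim: n p p0 px => // n IHn p p0 px.
move=> sp; have [[q c] Ep] : exists qc : {poly F} * F, p = qc.1 * 'X + qc.2%:P.
  by elim/poly_ind: p {p0 px sp} => [|q c _]; [exists (0, 0) | exists (q, c)];
     rewrite //= mul0r add0r.
rewrite /= in Ep; have [c0|c0] := eqVneq c 0; last first.
  exists (- c^-1 *: q); move: px; rewrite Ep rmorphD rmorphM /= map_polyX map_polyC /=.
  rewrite /root hornerMXaddC addr_eq0 => /eqP e.
  rewrite map_polyZ hornerZ mulrCA (mulrC x) e rmorphN /= fmorphV mulrNN.
  by rewrite mulVf // fmorph_eq0.
move: p0 px sp; rewrite {}Ep c0 addr0 => p0.
have q0 : q != 0 by apply: contraNneq p0 => ->; rewrite mul0r.
rewrite size_mulX // ltnS rmorphM /= map_polyX rootM => /orP[|/rootP].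
  exact: IHn.
by rewrite hornerX => /eqP; rewrite (negPf x0).
Qed.

(** The inverse of y is a polynomial in y over F, so a ring between F and L is a field. Later
    subfields are obtained by checking ring operations only. *)
Lemma algebraic_subring_divring (S : {pred L}) :
  subring_closed S -> (forall a, iota a \in S) -> divring_closed S.
Proof.
move=> [S1 SB SM] SF.
have SD : {in S &, forall x y, x + y \in S}.
  move=> x y xS yS; rewrite -[y]opprK; apply: (SB) => //; rewrite -sub0r.
  by apply: (SB) => //; rewrite -(subrr 1); apply: SB.
split=> // x y xS yS.
have [->|y0] := eqVneq y 0; first by rewrite invr0 mulr0 -(subrr 1); apply: SB.
apply: (SM) => //; have [g gy] := algebraic_inv_poly y0.
rewrite -[_^-1]mulr1 -gy mulKf // {x xS gy}.
elim/poly_ind: g => [|q c IHq]; first by rewrite rmorph0 horner0 -(rmorph0 iota).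
by rewrite rmorphD rmorphM /= map_polyX map_polyC /= hornerMXaddC; apply/SD/SF/SM.
Qed.

End AlgebraicOverF.

(** * Minimal polynomials and extension of partial automorphisms by Zorn's lemma *)

Section Conjugates.
Variables (F : fieldType) (L : closedFieldType) (iota : {rmorphism F -> L}).
Hypothesis L_alg : forall x : L, algebraicOver iota x.

(** Euclidean division by a nonzero polynomial of least size vanishing at x. *)
Lemma min_poly_ex (k : fieldType) (j : {rmorphism k -> L}) (x : L) :
  algebraicOver j x ->
  exists2 P : {poly k}, (1 < size P)%N &
    forall f : {poly k}, root (map_poly j f) x = (P %| f).
Proof.
case=> p p0 px.
have [n] := ubnP (size p); elim: n p p0 px => // n IHn p p0 px sp.
have [[q [q0 qx qp]]|noq] := pselect (exists q : {poly k},
    [/\ q != 0, root (map_poly j q) x & (size q < size p)%N]).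
  by apply: (IHn q) => //; apply: leq_trans qp _.
have pdvd f : root (map_poly j f) x = (p %| f).
  apply/idP/idP => [fx|]; last first.
    by move=> /dvdpP[g ->]; rewrite rmorphM /= rootM px orbT.
  apply/negPn/negP => npf; case: noq; exists (f %% p); split=> //; last exact: ltn_modpN0.
  move: fx; rewrite {1}(divp_eq f p) rmorphD rmorphM /= /root hornerD hornerM.
  by rewrite (rootP px) mulr0 add0r.
exists p => //; rewrite ltnNge; apply/negP => /size1_polyC Ep.
move: px p0; rewrite {}Ep map_polyC /= rootC => /eqP/eqP.
by rewrite fmorph_eq0 => /eqP->; rewrite polyC0 eqxx.
Qed.

Lemma algebraicOver_ext (k : fieldType) (j : {rmorphism k -> L}) (x : L) :
  (forall a, exists c, j c = iota a) -> algebraicOver iota x -> algebraicOver j x.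
Proof.
move=> kF [p p0 px]; pose g a := projT1 (cid (kF a)).
have gE a : j (g a) = iota a by rewrite /g; case: cid.
have E : map_poly j (map_poly g p) = map_poly iota p.
  apply/polyP => i; rewrite !coef_map_id0 ?gE ?rmorph0 //.
  by apply: (fmorph_inj j); rewrite gE !rmorph0.
exists (map_poly g p); last by rewrite E.
by apply: contraNneq p0 => e; move: E; rewrite e rmorph0 => /esym/eqP; rewrite map_poly_eq0.
Qed.

(* Graphs of F-embeddings into L of the subfields of L containing F. *)
Definition partial_aut (G : set (L * L)) : Prop :=
  [/\ forall a, G (iota a, iota a),
      forall u v, G u -> G v -> G (u - v),
      forall u v, G u -> G v -> G (u * v)
    & forall y, G (0, y) -> y = 0].

(** The graph of a map on i(k)[x] that carries i to j and x to y; it is well defined because every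
    relation satisfied by x over k passes to y. *)
Lemma adjoin_partial_aut (k : fieldType) (i j : {rmorphism k -> L}) (x y : L) :
  (forall a, exists2 c, i c = iota a & j c = iota a) ->
  (forall f : {poly k}, root (map_poly i f) x -> root (map_poly j f) y) ->
  partial_aut (range (fun f : {poly k} => ((map_poly i f).[x], (map_poly j f).[y]))).
Proof.
move=> kF ij; split.
- by move=> a; have [c ci cj] := kF a; exists c%:P => //; rewrite !map_polyC /= !hornerC ci cj.
- by move=> _ _ [f _ <-] [g _ <-]; exists (f - g) => //; rewrite !rmorphB /= !hornerE.
- by move=> _ _ [f _ <-] [g _ <-]; exists (f * g) => //; rewrite !rmorphM /= !hornerM.
- by move=> _ [f _ [/eqP/ij/rootP fy <-]].
Qed.

Section PartialAut.
Variables (G : set (L * L)) (G_aut : partial_aut G).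

Lemma partial_aut1 : G (1, 1).
Proof. by case: G_aut => GF _ _ _; rewrite -(rmorph1 iota). Qed.

Lemma partial_aut_fun x y z : G (x, y) -> G (x, z) -> y = z.
Proof.
case: G_aut => _ GB _ G0 /GB/[apply]; rewrite /GRing.add /= /GRing.opp /= => h.
by apply/eqP; rewrite -subr_eq0; apply/eqP/G0; rewrite -(subrr x).
Qed.

Definition partial_dom_fun : {pred L} := fun x => `[< exists y, G (x, y) >].

Lemma partial_dom_closed : divring_closed partial_dom_fun.
Proof.
case: (G_aut) => GF GB GM _; apply: (algebraic_subring_divring L_alg).
  split; first by apply/asboolP; exists 1; apply: partial_aut1.
    by move=> x y /asboolP[a Ga] /asboolP[b Gb]; apply/asboolP; exists (a - b);
       apply: (GB _ _ Ga Gb).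
  by move=> x y /asboolP[a Ga] /asboolP[b Gb]; apply/asboolP; exists (a * b);
     apply: (GM _ _ Ga Gb).
by move=> a; apply/asboolP; exists (iota a).
Qed.

Definition partial_dom : subfield L := Subfield partial_dom_closed.

Lemma partial_map_ex (x : partial_dom) : exists y, G (val x, y).
Proof. by have /asboolP := valP x. Qed.

Definition partial_map (x : partial_dom) : L := projT1 (cid (partial_map_ex x)).

Lemma partial_mapP x : G (val x, partial_map x).
Proof. exact: projT2 (cid (partial_map_ex x)). Qed.

Lemma partial_map_zmod : zmod_morphism partial_map.
Proof.
case: (G_aut) => _ GB _ _ x y; apply: (@partial_aut_fun (val (x - y))).
  exact: partial_mapP.
by rewrite rmorphB; apply: (GB (val x, _) (val y, _)); apply: partial_mapP.
Qed.

Lemma partial_map_monoid : monoid_morphism partial_map.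
Proof.
case: (G_aut) => _ _ GM _; split=> [|x y]; apply: partial_aut_fun (partial_mapP _) _.
  by rewrite rmorph1; apply: partial_aut1.
by rewrite rmorphM; apply: (GM (val x, _) (val y, _)); apply: partial_mapP.
Qed.

End PartialAut.

Lemma maximal_partial_aut (G0 : set (L * L)) : partial_aut G0 ->
  exists2 G, partial_aut G /\ (G0 `<=` G)%classic &
    forall H, partial_aut H -> (G `<=` H)%classic -> H = G.
Proof.
(* The predicate speaks of A joined with [G0], rather than of sets containing [G0], so that it holds
   for the union of the empty chain. *)
move=> G0a; pose P (A : set (L * L)) := partial_aut (A `|` G0)%classic.
have [A PA Amax] : exists2 A, P A & forall B, (A `<` B)%classic -> ~ P B.
  have [|A [PA Amax]] := @Zorn_bigcup _ P; last by exists A.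
  move=> C CP totC; rewrite /P.
  have dir u v : (\bigcup_(X in C) X `|` G0)%classic u ->
      (\bigcup_(X in C) X `|` G0)%classic v ->
      exists2 X, partial_aut X /\ (X `<=` \bigcup_(X in C) X `|` G0)%classic &
        X u /\ X v.
    have ub X : C X -> (X `|` G0 `<=` \bigcup_(X in C) X `|` G0)%classic.
      by move=> CX t [Xt|]; [left; exists X | right].
    case=> [[X CX Xu]|G0u]; case=> [[Y CY Yv]|G0v].
    - case: (totC X Y CX CY) => sub.
        by exists (Y `|` G0)%classic; split; [apply: CP|apply: ub|left; apply: sub|left].
      by exists (X `|` G0)%classic; split; [apply: CP|apply: ub|left|left; apply: sub].
    - by exists (X `|` G0)%classic; split; [apply: CP|apply: ub|left|right].
    - by exists (Y `|` G0)%classic; split; [apply: CP|apply: ub|right|left].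
    - by exists G0; split=> // t; right.
  split=> [a|u v|u v|y].
  - by right; case: G0a.
  - by move=> /dir/[apply] -[X [[_ XB _ _] subX] [Xu Xv]]; apply/subX/XB.
  - by move=> /dir/[apply] -[X [[_ _ XM _] subX] [Xu Xv]]; apply/subX/XM.
  - by move=> h; have [X [[_ _ _ X0] subX] [Xu _]] := dir _ _ h h; apply: X0.
exists (A `|` G0)%classic; first by split=> // t; right.
move=> H Ha sub; apply/seteqP; split=> // u Hu; left; apply: contrapT => nAu.
apply: (Amax H); last by rewrite /P (setUidl (subset_trans _ sub)) // => t; right.
split; first by apply: subset_trans sub => t; left.
by move=> /(_ u Hu).
Qed.

(** Let D be the domain of G. The image under G of the minimal polynomial of x over D has a root y
    in L; adjoining (x, y) yields a graph containing G, hence equal to G. *)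
Lemma maximal_partial_aut_total (G : set (L * L)) : partial_aut G ->
  (forall H, partial_aut H -> (G `<=` H)%classic -> H = G) ->
  forall x, exists y, G (x, y).
Proof.
move=> Ga Gmax x; pose D := partial_dom Ga.
pose fZ := GRing.isZmodMorphism.Build D L _ (@partial_map_zmod G Ga).
pose fM := GRing.isMonoidMorphism.Build D L _ (@partial_map_monoid G Ga).
pose f : {rmorphism D -> L} := HB.pack (@partial_map G Ga) fZ fM.
have DF a : exists2 c : D, val c = iota a & f c = iota a.
  have Da : iota a \in D by apply/asboolP; exists (iota a); case: (Ga).
  exists (SubfieldElt Da) => //; apply: (partial_aut_fun Ga (x := iota a)).
    exact: (partial_mapP (SubfieldElt Da)).
  by case: (Ga).
have DF' a : exists c : D, val c = iota a by case: (DF a) => c; exists c.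
have [P sP Pdvd] := min_poly_ex (algebraicOver_ext DF' (L_alg x)).
have /closed_rootP[y Py] : size (map_poly f P) != 1 by rewrite size_map_poly gtn_eqF.
have fxy (h : {poly D}) : root (map_poly val h) x -> root (map_poly f h) y.
  by rewrite Pdvd => /dvdpP[q ->]; rewrite rmorphM /= rootM Py orbT.
have Ha := adjoin_partial_aut DF fxy.
rewrite -(Gmax _ Ha).
  by exists y; exists 'X => //; rewrite !map_polyX !hornerX.
case=> a b Gab; have Da : a \in D by apply/asboolP; exists b.
exists (SubfieldElt Da)%:P => //; rewrite !map_polyC !hornerC /=; congr (_, _).
by apply: (partial_aut_fun Ga _ Gab); apply: (partial_mapP (SubfieldElt Da)).
Qed.

(** A field morphism is injective: if G sends y to 0 and y g(y) = 1, then G sends 1 to 0. Swapping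
    turns totality into surjectivity. *)
Lemma partial_aut_swap (G : set (L * L)) :
  partial_aut G -> partial_aut [set u | G (u.2, u.1)]%classic.
Proof.
case=> [GF GB GM G0]; split=> //=.
- by move=> u v Gu Gv; apply: (GB (_, _) (_, _)).
- by move=> u v Gu Gv; apply: (GM (_, _) (_, _)).
move=> y Gy0; apply/eqP/negPn/negP => y0.
have [g gy] := algebraic_inv_poly L_alg y0.
suff: G ((map_poly iota g).[y], (map_poly iota g).[0]).
  move=> h; have {h} : G (y * (map_poly iota g).[y], 0 * (map_poly iota g).[0]) := GM _ _ Gy0 h.
  rewrite gy mul0r => h; have {h} : G (iota 1 - 1, iota 1 - 0) := GB _ _ (GF 1) h.
  by rewrite rmorph1 subrr subr0 => /G0/eqP; rewrite oner_eq0.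
have GD u v : G u -> G v -> G (u + v).
  move=> Gu Gv; rewrite -[v]opprK; apply: (GB _ _ Gu); rewrite -sub0r; apply: (GB) => //.
  by have := GF 0; rewrite !rmorph0.
elim/poly_ind: (g) => [|q c IH]; first by rewrite rmorph0 !horner0; move: (GF 0); rewrite rmorph0.
rewrite rmorphD rmorphM /= map_polyX map_polyC /= !hornerMXaddC.
exact: (GD (_, _) (_, _) (GM _ _ IH Gy0) (GF c)).
Qed.

Lemma aut_of_total (G : set (L * L)) : partial_aut G ->
  (forall x, exists y, G (x, y)) -> (forall y, exists x, G (x, y)) ->
  exists s : aut L, forall x, G (x, s x).
Proof.
move=> Ga tot1 tot2; have Gi := partial_aut_swap Ga.
pose s x := projT1 (cid (tot1 x)); pose t y := projT1 (cid (tot2 y)).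
have sP x : G (x, s x) by rewrite /s; case: cid.
have tP y : G (t y, y) by rewrite /t; case: cid.
have sZ : zmod_morphism s.
  case: (Ga) => _ GB _ _ x y; apply: (partial_aut_fun Ga (sP _)).
  exact: (GB _ _ (sP x) (sP y)).
have sM : monoid_morphism s.
  case: (Ga) => _ _ GM _; split=> [|x y]; apply: (partial_aut_fun Ga (sP _)).
    exact: partial_aut1.
  exact: (GM _ _ (sP x) (sP y)).
have sB : bijective s.
  exists t => x; last exact: (partial_aut_fun Ga (sP _)).
  exact: (partial_aut_fun Gi (x := s x) (tP (s x)) (sP x)).
by exists (Aut sZ sM sB).
Qed.

(** A maximal graph is total, and so is its swap, which is again maximal. *)
Lemma partial_aut_extends (G0 : set (L * L)) : partial_aut G0 ->
  exists s : aut L, forall x y, G0 (x, y) -> s x = y.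
Proof.
move=> /maximal_partial_aut[G [Ga sub] Gmax].
have [|y|s sP] := aut_of_total Ga; last 1 first.
- by exists s => x y /sub; apply: partial_aut_fun.
- exact: maximal_partial_aut_total.
- have [|x] := maximal_partial_aut_total (partial_aut_swap Ga) _ y; last by exists x.
  move=> H /partial_aut_swap Ha sub'; apply/seteqP; split=> // -[a b] Hab.
  by rewrite /= -(Gmax _ Ha) // => -[c d] Gcd; apply: (sub' (d, c)).
Qed.

End Conjugates.

(** * Galois extensions inside an algebraic closure *)

Section Galois.
Variables (F : fieldType) (L : closedFieldType) (iota : {rmorphism F -> L}).
Hypothesis L_alg : forall x : L, algebraicOver iota x.
Implicit Types (k K : subfield L) (s t : aut L) (x y : L).

Definition fixing k s : Prop := forall x, x \in k -> s x = x.

Lemma fixingM k s t : fixing k s -> fixing k t -> fixing k (s * t)%g.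
Proof. by move=> ks kt x kx; rewrite -[LHS]/(s (t x)) kt ?ks. Qed.

Lemma autKV s : cancel s (s^-1)%g.
Proof. by move=> x; rewrite -[LHS]/((s^-1 * s)%g x) mulVg. Qed.

Lemma autVK s : cancel (s^-1)%g s.
Proof. by move=> x; rewrite -[LHS]/((s * s^-1)%g x) mulgV. Qed.

Lemma fixingV k s : fixing k s -> fixing k s^-1%g.
Proof. by move=> ks x kx; rewrite -{1}(ks x kx) autKV. Qed.

Lemma autXS t i x : (t ^+ i.+1)%g x = t ((t ^+ i)%g x).
Proof. by rewrite expgS. Qed.

Lemma fixingX (k : subfield L) t i : fixing k t -> fixing k (t ^+ i)%g.
Proof. by move=> tk; elim: i => [|i IHi] x kx //; rewrite autXS IHi ?tk. Qed.

Lemma polyOver_subfield k (f : {poly L}) :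
  f \is a polyOver k -> exists g : {poly k}, f = map_poly val g.
Proof.
move=> /polyOverP kf; exists (\poly_(i < size f) (SubfieldElt (kf i))).
apply/polyP => i; rewrite coef_map coef_poly /=.
by case: ltnP => // ?; rewrite nth_default // rmorph0.
Qed.

Lemma fixing_horner k s (g : {poly k}) x : fixing k s ->
  s (map_poly val g).[x] = (map_poly val g).[s x].
Proof.
move=> ks; rewrite -horner_map; congr _.[_]; apply/polyP => i.
have kg : (map_poly val g)`_i \in k by rewrite coef_map; apply: valP.
by rewrite [LHS]coef_map /= ks.
Qed.

Section Over.
Variables (k : subfield L).
Hypothesis kF : forall a, iota a \in k.

(** The multiples of P are the polynomials vanishing at x and L is a domain, so P is prime;
    comparing degrees, it is irreducible. *)
Lemma subfield_min_poly x : exists P : {poly k},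
  irreducible_poly P /\ forall f : {poly k}, root (map_poly val f) x = (P %| f).
Proof.
have kF' a : exists c : k, val c = iota a by exists (SubfieldElt (kF a)).
have [P sP Pdvd] := min_poly_ex (algebraicOver_ext kF' (L_alg x)).
have P0 : P != 0 by rewrite -size_poly_gt0 ltnW.
exists P; split=> //; split=> // q q1 /dvdpP[r EP].
have := dvdpp P; rewrite -Pdvd {1}EP rmorphM rootM /= !Pdvd => /orP[Pr|Pq].
  have /eqp_size es : r %= P by rewrite /eqp Pr andbT EP dvdp_mulr.
  move: P0 q1 es; rewrite EP mulf_eq0 => /norP[r0 q0].
  rewrite size_mul // => q1; rewrite -size_poly_gt0 in q0.
  case: (size q) q0 q1 => [|[|n]] // _ _; rewrite addnS /= => /eqP.
  by rewrite -[X in X == _]addn0 eqn_add2l.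
by rewrite /eqp Pq andbT EP dvdp_mull.
Qed.

Lemma conj_aut x y :
  (forall f : {poly k}, root (map_poly val f) x -> root (map_poly val f) y) ->
  exists2 s, fixing k s & s x = y.
Proof.
move=> kxy; have kF' a : exists2 c : k, val c = iota a & val c = iota a.
  by exists (SubfieldElt (kF a)).
have [s sP] := partial_aut_extends L_alg (adjoin_partial_aut kF' kxy).
exists s => [z kz|]; apply: sP.
  by exists (SubfieldElt kz)%:P => //; rewrite map_polyC !hornerC.
by exists 'X => //; rewrite map_polyX !hornerX.
Qed.

Lemma conj_aut_irr (p : {poly k}) x y : irreducible_poly p ->
  root (map_poly val p) x -> root (map_poly val p) y ->
  exists2 s, fixing k s & s x = y.
Proof.
move=> [_ pirr] px py; have [P [[sP _] Pdvd]] := subfield_min_poly x.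
apply: conj_aut => f; rewrite Pdvd => Pf.
have /eqp_dvdl e : P %= p by apply: pirr; rewrite -?Pdvd ?gtn_eqF.
by move: Pf; rewrite e => /dvdpP[g ->]; rewrite rmorphM rootM py orbT.
Qed.

Lemma fixing_root (f : {poly k}) s x : fixing k s ->
  root (map_poly val f) x -> root (map_poly val f) (s x).
Proof.
by move=> ks /rootP fx; apply/rootP; rewrite -fixing_horner // fx rmorph0.
Qed.

(** Converse of [galois_stable] and [galois_fixed]. The roots of an irreducible polynomial are
    conjugate under Aut(L/k), so if one lies in K, stability puts all of them there. *)
Lemma galois_ext_of_fixed K : {subset k <= K} ->
  (forall s, fixing k s -> forall x, x \in K -> s x \in K) ->
  (forall x, x \in K -> (forall s, fixing k s -> s x = x) -> x \in k) ->
  galois_ext K k.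
Proof.
move=> kK Kst Kfix; have kF' a : exists c : k, val c = iota a by exists (SubfieldElt (kF a)).
have roots (p : {poly k}) x (rs : seq L) : irreducible_poly p -> x \in K ->
    root (map_poly val p) x ->
    map_poly val p = lead_coef (map_poly val p) *: \prod_(r <- rs) ('X - r%:P) ->
    {subset rs <= K}.
  move=> pirr Kx px Ep r rrs; have [|s ks <-] := conj_aut_irr (y := r) pirr px.
    rewrite Ep rootZ ?lead_coef_eq0 ?map_poly_eq0 ?root_prod_XsubC //.
    by rewrite -size_poly_gt0 ltnW //; case: pirr.
  exact: Kst.
split=> //.
- by move=> x _; apply: algebraicOver_ext kF' (L_alg x).
- move=> p pirr [x Kx px]; have [rs Ep] := closed_field_poly_normal (map_poly (val : k -> L) p).
  have p0 : lead_coef (map_poly (val : k -> L) p) != 0.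
    by rewrite lead_coef_eq0 map_poly_eq0 -size_poly_gt0 ltnW //; case: pirr.
  have rsE r : (r \in rs) = root (map_poly val p) r by rewrite Ep rootZ ?root_prod_XsubC.
  have rsK := roots _ _ _ pirr Kx px Ep.
  (* Artin's argument: Aut(L/k) permutes the distinct roots of p, so Q has coefficients in k; it
     vanishes at x, hence p divides the separable Q. *)
  pose Q : {poly L} := \prod_(r <- undup rs) ('X - r%:P).
  have [g Eg] : exists g : {poly k}, Q = map_poly val g.
    apply: polyOver_subfield; apply/polyOverP => i; apply: Kfix => [|s ks].
      apply/(polyOverP (S := K)); rewrite /Q big_seq_cond; apply: rpred_prod => r.
      by rewrite andbT mem_undup => /rsK; rewrite polyOverXsubC.
    rewrite -coef_map rmorph_prod /Q /=; congr _`_i.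
    under eq_bigr do rewrite rmorphB /= map_polyX map_polyC /=.
    rewrite -(big_map s xpredT (fun r => ('X - r%:P : {poly L}))).
    have us : uniq (map s (undup rs)) by rewrite map_inj_uniq ?undup_uniq //; apply: fmorph_inj.
    have sub : {subset map s (undup rs) <= undup rs}.
      by move=> y /mapP[r rr ->]; move: rr; rewrite !mem_undup !rsE; apply: fixing_root.
    have ss : (size (undup rs) <= size (map s (undup rs)))%N by rewrite size_map.
    have e := (uniq_min_size us sub ss).2.
    by congr polyseq; apply: perm_big; apply: uniq_perm us (undup_uniq _) e.
  have gsep : separable_poly g by rewrite -(separable_map val) -Eg separable_prod_XsubC undup_uniq.
  apply: dvdp_separable gsep; have [P [[sP _] Pdvd]] := subfield_min_poly x.
  have /eqp_dvdl <- : P %= p by case: (pirr) => _ h; apply: h; rewrite -?Pdvd ?gtn_eqF.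
  by rewrite -Pdvd -Eg root_prod_XsubC mem_undup rsE.
- move=> p pirr [x Kx px]; have [rs Ep] := closed_field_poly_normal (map_poly (val : k -> L) p).
  exists rs; first exact: roots _ _ _ pirr Kx px Ep.
  rewrite Ep eqp_scale // lead_coef_eq0 map_poly_eq0 -size_poly_gt0 ltnW //; by case: pirr.
Qed.

(** Aut(L/k) is transitive on the roots of the minimal polynomial, and separability makes them
    simple; scaled to be monic, it is the product over the orbit. *)
Lemma separable_orbit x (f : {poly k}) : separable_poly f -> root (map_poly val f) x ->
  exists rs : seq L, exists P : {poly k},
  [/\ uniq rs, x \in rs, map_poly val P = \prod_(r <- rs) ('X - r%:P),
      irreducible_poly P
    & forall y, y \in rs <-> exists2 s, fixing k s & s x = y].
Proof.
move=> fsep fx; have [P0 [P0irr P0dvd]] := subfield_min_poly x.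
have P0n : P0 != 0 by rewrite -size_poly_gt0 ltnW //; case: P0irr.
pose P := (lead_coef P0)^-1 *: P0.
have PP : P %= P0 by rewrite eqp_scale ?invr_eq0 ?lead_coef_eq0.
have Pirr : irreducible_poly P.
  split=> [|g g1 gP]; first by rewrite (eqp_size PP); case: P0irr.
  rewrite (eqp_rtrans PP); case: P0irr => _ irr; apply: irr => //.
  by rewrite -(eqp_dvdr _ PP).
have Pdvd g : root (map_poly val g) x = (P %| g) by rewrite P0dvd (eqp_dvdl _ PP).
have [rs EP] := closed_field_poly_normal (map_poly (val : k -> L) P).
have Pmon : lead_coef (map_poly (val : k -> L) P) = 1.
  by rewrite lead_coef_map lead_coefZ mulVf ?lead_coef_eq0 ?rmorph1.
rewrite Pmon scale1r in EP.
have rsE r : (r \in rs) = root (map_poly val P) r by rewrite EP root_prod_XsubC.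
have Px : root (map_poly val P) x by rewrite Pdvd.
exists rs, P; split=> //; last 1 first.
- move=> y; rewrite rsE; split; last by case=> s ks <-; apply: fixing_root.
  exact: conj_aut_irr Pirr Px.
- rewrite -separable_prod_XsubC -EP separable_map.
  by apply: dvdp_separable fsep; rewrite -Pdvd.
- by rewrite rsE.
Qed.

(* The polynomial g, reduced modulo the minimal polynomial of z, takes the
   value x at all the conjugates of z, which exceed its degree. *)
Lemma simple_fixed z (f g : {poly k}) x :
  separable_poly f -> root (map_poly val f) z -> x = (map_poly val g).[z] ->
  (forall s, fixing k s -> s x = x) -> x \in k.
Proof.
move=> fsep fz Ex xfix; have [rs [P [urs zrs EP Pirr rsP]]] := separable_orbit fsep fz.
have P0 : P != 0 by rewrite -size_poly_gt0 ltnW //; case: Pirr.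
pose h := map_poly val (g %% P) : {poly L}.
have hz : h.[z] = x.
  rewrite Ex {1}(divp_eq g P) rmorphD rmorphM /= hornerD hornerM.
  by rewrite EP (rootP _ : (\prod_(r <- rs) ('X - r%:P)).[z] = 0) ?root_prod_XsubC ?mulr0 ?add0r.
have hr r : r \in rs -> root (h - x%:P) r.
  move=> /rsP[s ks <-].
  by rewrite /root !hornerE subr_eq0 -(xfix s ks) -hz /h fixing_horner.
have sh : (size h <= size rs)%N.
  by rewrite -ltnS -(size_prod_XsubC rs id) -EP size_map_poly size_map_poly ltn_modpN0.
have hx : h - x%:P == 0.
  apply: contraTT isT => hx0; suff: (size rs < size rs)%N by rewrite ltnn.
  apply: leq_trans (max_poly_roots hx0 _ urs) _; first by apply/allP.
  apply: leq_trans (size_polyD _ _) _; rewrite size_polyN geq_max sh.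
  by apply: leq_trans (size_polyC_leq1 _) _; case: (rs) zrs.
suff -> : x = val (g %% P)`_0 by apply: valP.
by move: hx; rewrite subr_eq0 => /eqP e; rewrite -coef_map -/h e coefC.
Qed.

Lemma separable_fixed x (f : {poly k}) :
  separable_poly f -> root (map_poly val f) x ->
  (forall s, fixing k s -> s x = x) -> x \in k.
Proof. by move=> fs fx; apply: (simple_fixed (g := 'X) fs fx); rewrite map_polyX hornerX. Qed.

Variables (K : subfield L).
Hypothesis KG : galois_ext K k.

(** The orbit is the set of roots of the minimal polynomial, which is separable and splits in K. *)
Lemma galois_orbit x : x \in K -> exists rs : seq L,
  [/\ uniq rs, x \in rs, {subset rs <= K}
    & forall y, y \in rs <-> exists2 s, fixing k s & s x = y].
Proof.
case: KG => kK _ Ksep Knorm Kx; have [P [Pirr Pdvd]] := subfield_min_poly x.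
have Px : root (map_poly val P) x by rewrite Pdvd.
have Psep := Ksep P Pirr (ex_intro2 _ _ x Kx Px).
have [rs' rsK EP] := Knorm P Pirr (ex_intro2 _ _ x Kx Px).
have [rs [Q [urs xrs _ _ rsP]]] := separable_orbit Psep Px.
exists rs; split=> // y /rsP[s ks <-]; apply: rsK.
by rewrite -root_prod_XsubC -(eqp_root EP) fixing_root.
Qed.

Lemma galois_stable s x : fixing k s -> x \in K -> s x \in K.
Proof.
by move=> ks Kx; have [rs [_ _ rsK rsP]] := galois_orbit Kx; apply/rsK/rsP; exists s.
Qed.

Lemma galois_fixed x : x \in K -> (forall s, fixing k s -> s x = x) -> x \in k.
Proof.
case: KG => _ _ Ksep _ Kx; have [P [Pirr Pdvd]] := subfield_min_poly x.
have Px : root (map_poly val P) x by rewrite Pdvd.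
exact: separable_fixed (Ksep P Pirr (ex_intro2 _ _ x Kx Px)) Px.
Qed.

End Over.

Lemma restrict_aut K k s :
  (forall x, x \in K -> s x \in K) -> (forall x, x \in K -> (s^-1)%g x \in K) ->
  fixing k s -> exists t : galgrp K k, forall x : K, val (val t x) = s (val x).
Proof.
move=> sK sVK ks; pose f (x : K) : K := SubfieldElt (sK _ (valP x)).
pose g (x : K) : K := SubfieldElt (sVK _ (valP x)).
have fZ : zmod_morphism f by move=> x y; apply: val_inj; rewrite /= !rmorphB.
have fM : monoid_morphism f.
  by split=> [|x y]; apply: val_inj; rewrite /= ?rmorph1 ?rmorphM.
have fB : bijective f.
  by exists g => x; apply: val_inj; [apply: (autKV s) | apply: (autVK s)].
have fk : Aut fZ fM fB \in fixes k.
  by apply/asboolP => x kx; apply: val_inj; rewrite /= ks.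
by exists (GalElt fk).
Qed.



Lemma galois_restrict K k s : (forall a, iota a \in k) -> galois_ext K k ->
  fixing k s -> exists t : galgrp K k, forall x : K, val (val t x) = s (val x).
Proof.
move=> kF KG ks; apply: restrict_aut => // x Kx.
  exact: (galois_stable kF KG ks Kx).
exact: (galois_stable kF KG (fixingV ks) Kx).
Qed.

End Galois.

(** * Units modulo an odd prime power *)

Section OddPrimePower.
Variables (p : nat) (p_prime : prime p) (p_odd : odd p).
Local Open Scope nat_scope.

(** The units of Z/q are the automorphisms of the cyclic group of order q, whose structure is known:
    for q = p they reduce to their cyclic p'-part, and for larger q the oddness of p makes them
    cyclic. *)
Lemma units_Zp_odd_prime_power_cyclic n : 0 < n -> cyclic (units_Zp (p ^ n)).
Proof.
move=> n_gt0; set q := p ^ n; have q_gt1 : 1 < q by rewrite -(exp1n n) ltn_exp2r ?prime_gt1.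
pose a : 'Z_q := Zp1; have oa : #[a]%g = q by rewrite order_Zp1 Zp_cast.
rewrite -[q]oa (isog_cyclic (Zp_unit_isog a)).
have pG : (p.-group <[a]>)%g by rewrite /pgroup -orderE oa pnatX pnat_id.
have ntG : (<[a]> != 1)%g by rewrite -cardG_gt1 -orderE oa.
have [m [_ [_ cF _ _]]] := cyclic_pgroup_Aut_structure pG (cycle_cyclic a) ntG.
case: eqP => [_ /(congr1 (@cyclic _)) e|_ [t [_ _ _]]]; first exact: etrans e cF.
by rewrite p_odd => -[[]].
Qed.

Lemma expn_1_mod b c j : b = 1 + p * c ->
  exists e, b ^ j = 1 + j * p * c + p ^ 2 * e.
Proof.
move=> ->; elim: j => [|j [e IH]]; first by exists 0; rewrite muln0.
by exists (e + j * c ^ 2 + p * c * e); rewrite expnS IH; ring.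
Qed.

(** Modulo p^2 the sum is p + p c C(p,2), and p divides C(p,2) because p is odd. *)
Lemma geometric_sum_p b c : b = 1 + p * c ->
  exists e, \sum_(j < p) b ^ j = p * (1 + p * e).
Proof.
move=> Eb; have [e Ee] : exists e, forall j, b ^ j = 1 + j * p * c + p ^ 2 * e j.
  pose f j := projT1 (cid (expn_1_mod j Eb)).
  by exists f => j; rewrite /f; case: cid.
have /dvdnP[h Eh] : p %| 'C(p, 2) by rewrite prime_dvd_bin ?odd_prime_gt2.
exists (h * c + \sum_(j < p) e j).
under eq_bigr do rewrite Ee; rewrite !big_split /= sum1_card card_ord -big_distrr /=.
have -> : \sum_(i < p) i * p * c = p * (p * (h * c)); last by ring.
rewrite -!big_distrl /= -(big_mkord xpredT (fun i => i)) bin2_sum Eh; ring.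
Qed.

Lemma geometric_sum_mul a k m :
  \sum_(j < k * m) a ^ j = (\sum_(j < k) a ^ j) * \sum_(j < m) (a ^ k) ^ j.
Proof.
elim: m => [|m IHm]; first by rewrite muln0 !big_ord0 muln0.
rewrite mulnS addnC big_split_ord /= IHm big_ord_recr /= mulnDr; congr addn.
by rewrite big_distrl /=; apply: eq_bigr => j _; rewrite expnD expnM mulnC.
Qed.

(** The sum over p^(i+1) terms is the sum over p^i terms times a sum of p terms in base a^(p^i),
    again 1 modulo p; each step contributes exactly one factor p. *)
Lemma geometric_sum_pX a c i : a = 1 + p * c ->
  exists e, \sum_(j < p ^ i) a ^ j = p ^ i * (1 + p * e).
Proof.
move=> Ea; elim: i => [|i [e IH]].
  by exists 0; rewrite expn0 big_ord1 muln0.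
have [e0 Ee0] := expn_1_mod (p ^ i) Ea.
have [|e1 Ee1] := @geometric_sum_p (a ^ (p ^ i)) (p ^ i * c + p * e0).
  by rewrite Ee0; ring.
exists (e + e1 + p * e * e1).
by rewrite expnSr geometric_sum_mul IH Ee1; ring.
Qed.

(** * Kernels and images of u - 1 and of the sum of the powers of u on Z/q *)

Section UnitSums.
Variables (n : nat) (n_gt0 : 0 < n).
Local Notation q := (p ^ n).
Local Open Scope ring_scope.

Lemma prime_power_gt1 : (1 < q)%N.
Proof. by rewrite -(exp1n n) ltn_exp2r ?prime_gt1. Qed.

Lemma Zq_nat_eq0 (k : nat) : (k%:R == 0 :> 'Z_q) = (q %| k)%N.
Proof. by rewrite -val_eqE /= val_Zp_nat ?prime_power_gt1. Qed.

(* With u = 1 + p^k t and t a unit, the sum of the powers of u over a period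
   is p^(n-k) times a unit, so it has the same image and kernel as p^(n-k). *)
Lemma unit_sum_structure (u : {unit 'Z_q}) :
  let N := \sum_(i < #[u]%g) val u ^+ i in
  [\/ val u - 1 \is a GRing.unit, val u - 1 = 0 /\ N = 1
    | exists k : nat, exists t, exists s, [/\ (k <= n)%N, t \is a GRing.unit,
        s \is a GRing.unit, val u - 1 = (p ^ k)%:R * t & N = (p ^ (n - k))%:R * s]].
Proof.
move=> N; have q_gt1 := prime_power_gt1.
pose a := nat_of_ord (val u); have Eu : val u = a%:R by rewrite natr_Zp.
have a_coprime : coprime q a by rewrite -unitZpE // -Eu (valP u).
have a_gt0 : (0 < a)%N by case: (a) a_coprime => //; rewrite /coprime gcdn0 gtn_eqF.
have Eu1 : val u - 1 = a.-1%:R by rewrite Eu -{1}(prednK a_gt0) -natr1 addrK.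
have unitE k : (k%:R : 'Z_q) \is a GRing.unit = ~~ (p %| k)%N.
  by rewrite unitZpE // coprime_pexpl // prime_coprime.
have [pa|npa] := boolP (p %| a.-1)%N; last by constructor 1; rewrite Eu1 unitE.
have [a1|a1] := eqVneq (val u) 1.
  constructor 2; rewrite a1 subrr /N (_ : u = 1%g) ?order1 ?big_ord1 //.
  exact: val_inj.
constructor 3.
have a1_gt0 : (0 < a.-1)%N by rewrite lt0n; apply: contraNneq a1 => a10; rewrite -subr_eq0 Eu1 a10.
have [t pt Et] := pfactor_coprime p_prime a1_gt0.
pose k := logn p a.-1; rewrite -/k in Et.
have Ea : a = (1 + p * (a.-1 %/ p))%N by rewrite mulnC divnK // add1n prednK.
have p1e e : ~~ (p %| 1 + p * e)%N.
  by rewrite dvdn_addl ?dvdn_mulr // dvdn1 gtn_eqF ?prime_gt1.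
(* The integer a^(p^i) - 1 is a - 1 times a geometric sum, so it has valuation k + i. This gives the
   order p^(n-k) of u, and with it the valuation of N. *)
have uX i : (val u ^+ (p ^ i) == 1) = (n <= k + i)%N.
  rewrite -subr_eq0 subrX1 Eu1 Eu; under eq_bigr do rewrite -natrX.
  rewrite -natr_sum -natrM Zq_nat_eq0; have [e ->] := geometric_sum_pX i Ea.
  have -> : (a.-1 * (p ^ i * (1 + p * e)) = t * (1 + p * e) * p ^ (k + i))%N.
    by rewrite Et expnD; ring.
  rewrite Gauss_dvdr ?dvdn_Pexp2l ?prime_gt1 //.
  by rewrite coprime_pexpl // coprimeMr pt prime_coprime ?p1e.
have kn : (k <= n)%N.
  rewrite leqNgt; apply/negP => nk; have := uX 0%N; rewrite expn0 expr1 (negPf a1).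
  by rewrite addn0 (ltnW nk).
have ordu : #[u]%g = (p ^ (n - k))%N.
  have uXE m : (u ^+ m == 1)%g = (val u ^+ m == 1) by rewrite -val_eqE /= FinRing.val_unitX.
  have : (#[u]%g %| p ^ (n - k))%N by rewrite order_dvdn uXE uX subnKC.
  case/dvdn_pfactor => // i ile Ei; rewrite Ei; congr expn; apply/eqP.
  by rewrite eqn_leq ile leq_subLR -uX -uXE -Ei expg_order eqxx.
have [e Ee] := geometric_sum_pX (n - k) Ea.
exists k, t%:R, (1 + p * e)%:R; split=> //.
- by rewrite unitE -prime_coprime.
- by rewrite unitE.
- by rewrite Eu1 Et natrM mulrC.
rewrite /N ordu -natrM -Ee natr_sum; apply: eq_bigr => i _.
by rewrite Eu natrX.
Qed.

Lemma pX_mul_eq0 (k : nat) (x : 'Z_q) : (k <= n)%N ->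
  (p ^ k)%:R * x = 0 -> exists y, x = (p ^ (n - k))%:R * y.
Proof.
move=> kn /eqP; rewrite -[x]natr_Zp -natrM Zq_nat_eq0 -{1}(subnKC kn) expnD.
rewrite dvdn_pmul2l ?expn_gt0 ?prime_gt0 // => /dvdnP[y ->].
by exists y%:R; rewrite natrM mulrC.
Qed.

(** The kernel of N modulo the image of u - 1 is H^1 of the cyclic group generated by u. In the main
    case N is p^(n-k) and u - 1 is p^k up to units, and the kernel of p^(n-k) is the image of
    p^k. *)
Lemma unit_sum_ker (u : {unit 'Z_q}) (x : 'Z_q) :
  (\sum_(i < #[u]%g) val u ^+ i) * x = 0 -> exists y, x = (val u - 1) * y.
Proof.
have [U _|[_ ->]|[k [t [s [kn Ut Us -> ->]]]]] := unit_sum_structure u.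
- by exists ((val u - 1)^-1 * x); rewrite mulVKr.
- by rewrite mul1r => ->; exists 0; rewrite mulr0.
rewrite mulrAC -mulrA => /(pX_mul_eq0 (leq_subr _ _)); rewrite subKn // => -[y].
move=> /(canRL (mulrK Us)) ->; exists (t^-1 * y / s).
by rewrite -!mulrA mulVKr.
Qed.

(** The same argument with the two maps exchanged, for the Tate group H^0. *)
Lemma unit_sum_fixed (u : {unit 'Z_q}) (x : 'Z_q) :
  (val u - 1) * x = 0 -> exists y, x = (\sum_(i < #[u]%g) val u ^+ i) * y.
Proof.
have [U|[_ ->]|[k [t [s [kn Ut Us -> ->]]]]] := unit_sum_structure u.
- by move=> /(canRL (mulKr U)); rewrite mulr0 => ->; exists 0; rewrite mulr0.
- by exists x; rewrite mul1r.
rewrite -mulrA => /(pX_mul_eq0 kn)[y].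
move=> /(canRL (mulKr Ut)) ->; exists (s^-1 * t^-1 * y).
by rewrite -!mulrA mulVKr // mulrCA.
Qed.

End UnitSums.
End OddPrimePower.

(** * Kummer theory *)

Section SubfieldGen.
Variable L : fieldType.
Implicit Types (K : subfield L) (A : set L).

Lemma mem_subfield_gen A x : A x -> x \in subfield_gen A.
Proof. by move=> Ax; apply/asboolP => K; apply. Qed.

Lemma subfield_gen_sub A K : (forall a, A a -> a \in K) -> {subset subfield_gen A <= K}.
Proof. by move=> AK x /asboolP; apply. Qed.

Lemma subfield_gen_stable A K (s : aut L) : (forall a, A a -> s a \in K) ->
  forall x, x \in subfield_gen A -> s x \in K.
Proof.
move=> sAK; pose D : {pred L} := [pred x | s x \in K].
have cl : divring_closed D.
  split=> [|x y|x y]; rewrite !inE.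
  - by rewrite rmorph1 rpred1.
  - by rewrite rmorphB; apply: rpredB.
  - by rewrite fmorph_div; apply: rpred_div.
by move=> x; apply: (@subfield_gen_sub A (Subfield cl)).
Qed.

Lemma aut_subfield_gen_eq A (s t : aut (subfield_gen A)) :
  (forall a : subfield_gen A, A (val a) -> s a = t a) -> s = t.
Proof.
move=> stA; pose E : {pred L} := fun x : L =>
  `[< exists2 y : subfield_gen A, val y = x & s y = t y >].
have cl : divring_closed E.
  split; first by apply/asboolP; exists 1; rewrite ?rmorph1.
    move=> _ _ /asboolP[x <- ex] /asboolP[y <- ey]; apply/asboolP.
    by exists (x - y); rewrite ?rmorphB //= ex ey.
  move=> _ _ /asboolP[x <- ex] /asboolP[y <- ey]; apply/asboolP.
  by exists (x / y); rewrite ?fmorph_div //= ex ey.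
apply: aut_eqP => x; have : val x \in Subfield cl.
  apply: subfield_gen_sub (valP x) => a Aa; apply/asboolP.
  by exists (SubfieldElt (mem_subfield_gen Aa)) => //; apply: stA.
by move=> /asboolP[y /val_inj ->].
Qed.

End SubfieldGen.

Lemma sum_shift (V : zmodType) (G : nat -> V) (d : nat) :
  G d = G 0%N -> \sum_(i < d) G i.+1 = \sum_(i < d) G i.
Proof.
move=> Gd; apply: (addrI (G 0%N)); rewrite -(big_ord_recl d (fun i => G i)).
by rewrite big_ord_recr /= Gd addrC.
Qed.

(** X^m - 1 is separable, so it has m distinct roots, and these include a primitive one. *)
Lemma closed_prim_root (L : closedFieldType) (m : nat) :
  m%:R != 0 :> L -> exists z : L, m.-primitive_root z.
Proof.
move=> m0; have m_gt0 : (0 < m)%N by case: m m0; rewrite ?eqxx.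
have [rs Ers] := closed_field_poly_normal ('X^m - 1 : {poly L}).
have lc : lead_coef ('X^m - 1 : {poly L}) = 1.
  exact: (monicP (monic_Xn_sub_1 L m_gt0)).
rewrite lc scale1r in Ers; have urs : uniq rs.
  by rewrite -separable_prod_XsubC -Ers separable_Xn_sub_1.
have /hasP[z _ pz] : has m.-primitive_root rs; last by exists z.
apply: has_prim_root => //; last by rewrite -ltnS -(size_prod_XsubC rs id) -Ers size_XnsubC.
by apply/allP => r; rewrite -root_prod_XsubC -Ers.
Qed.

Section Kummer.
Variables (F : fieldType) (L : closedFieldType) (iota : {rmorphism F -> L}).
Hypothesis L_alg : forall x : L, algebraicOver iota x.
Variables (m : nat) (k : subfield L).
Hypotheses (m_neq0 : m%:R != 0 :> L) (kF : forall a, iota a \in k).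
Implicit Types (s : aut L) (b x : L).

Lemma separable_Xn_sub_C (K : fieldType) (c : K) :
  m%:R != 0 :> K -> c != 0 -> separable_poly ('X^m - c%:P).
Proof.
(* Bezout relation for f = X^m - c: the constant X f' - m f = m c is nonzero. *)
move=> m0 c0; rewrite separable_poly.unlock; apply/Bezout_coprimepP; exists (- m%:R%:P, 'X) => /=.
have m_gt0 : (0 < m)%N by case: (m) m0; rewrite ?eqxx.
rewrite derivB derivC subr0 derivXn mulrnAr -exprS prednK //.
have -> : - m%:R%:P * ('X^m - c%:P) + 'X^m *+ m = (m%:R * c)%:P.
  by rewrite polyCM polyC_natr -mulr_natl; ring.
by rewrite polyC_eqp1 mulf_neq0.
Qed.

Lemma kummer_root_fixed b : b ^+ m \in k -> (forall s, fixing k s -> s b = b) -> b \in k.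
Proof.
move=> kb bfix; have [->|b0] := eqVneq b 0; first exact: rpred0.
pose c : k := SubfieldElt kb.
apply: (separable_fixed L_alg kF (f := 'X^m - c%:P)) bfix.
  apply: separable_Xn_sub_C; last by rewrite -(inj_eq val_inj) rmorph0 expf_neq0.
  by rewrite -(fmorph_eq0 (val : k -> L)) rmorph_nat.
have -> : map_poly val ('X^m - c%:P) = 'X^m - (b ^+ m)%:P :> {poly L}.
  by rewrite rmorphB; congr (_ - _); [exact: map_polyXn | exact: map_polyC].
by rewrite /root !hornerE subrr.
Qed.

Hypothesis k_mu : forall w : L, w ^+ m = 1 -> w \in k.

Lemma kummer_char s b : fixing k s -> b != 0 -> b ^+ m \in k ->
  s b / b \in k /\ (s b / b) ^+ m = 1.
Proof.
move=> ks b0 kb; suff e : (s b / b) ^+ m = 1 by split=> //; apply: k_mu.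
by rewrite expr_div_n -rmorphXn /= ks // divff // expf_neq0.
Qed.

(* Two summands on which some s acts by different scalars can be separated by
   applying s minus one of the scalars, which shortens the sum; if there are
   none, all the t.2 and x agree up to elements of k. *)
Lemma kummer_eigen (sq : seq (L * L)) x :
  (forall t, t \in sq -> [/\ t.1 \in k, t.2 != 0 & t.2 ^+ m \in k]) ->
  x = \sum_(t <- sq) t.1 * t.2 -> x != 0 ->
  (forall s, fixing k s -> s x / x \in k) ->
  exists2 t, t \in sq & x / t.2 \in k.
Proof.
have [N] := ubnP (size sq); elim: N sq => // N IHN sq szN sqP Ex x0 xk.
have [same|] := pselect (forall t s, t \in sq -> fixing k s -> s x / x = s t.2 / t.2).
  case: sq sqP Ex same {szN} => [_|t0 sq sqP Ex same].
    by rewrite big_nil => e; rewrite e eqxx in x0.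
  exists t0; first exact: mem_head.
  have [_ t0n t0k] := sqP _ (mem_head _ _).
  (* Each t.2 / t0.2 is fixed by Aut(L/k), all eigenvalues being that of x, and its m-th power is in
     k; so it lies in k. *)
  rewrite Ex mulr_suml big_seq; apply: rpred_sum => t tsq.
  have [k1 tn tk] := sqP _ tsq; rewrite -mulrA; apply: rpredM => //.
  apply: kummer_root_fixed => [|s ks]; first by rewrite expr_div_n rpred_div.
  have := same _ _ tsq ks; rewrite (same _ _ (mem_head _ _) ks) => /eqP.
  rewrite eqr_div // => /eqP e; rewrite fmorph_div; apply/eqP.
  by rewrite eqr_div ?fmorph_eq0 // -e mulrC.
move=> /existsNP[t /existsNP[s /not_implyP[tsq /not_implyP[ks /eqP ne]]]].
pose chi (b : L) := s b / b; set c := s x / x in ne; rewrite -/(chi t.2) in ne.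
have chiE b : b != 0 -> s b = chi b * b by move=> b0; rewrite divfK.
(* The operator s - chi t.2 kills the term t and multiplies x by the nonzero c - chi t.2; after
   division the shorter sum is still x. *)
pose sq' := [seq (u.1 * (chi u.2 - chi t.2) / (c - chi t.2), u.2) | u <- rem t sq].
have chik u : u \in sq -> chi u.2 \in k.
  by move=> /sqP[_ u0 uk]; have [] := kummer_char ks u0 uk.
have [|||t'] := IHN sq' _ _ _ x0 xk.
- by rewrite size_map size_rem // prednK //; case: (sq) tsq.
- move=> _ /mapP[u /mem_rem usq ->] /=; have [u1 u2 uk] := sqP _ usq; split=> //.
  by apply: rpred_div; [apply: rpredM => //|]; apply: rpredB; rewrite ?xk ?chik.
- rewrite big_map /=; have cn : c - chi t.2 != 0 by rewrite subr_eq0.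
  apply: (mulfI cn); rewrite mulr_sumr.
  transitivity (s x - chi t.2 * x); first by rewrite mulrBl divfK.
  rewrite {1 2}Ex rmorph_sum mulr_sumr -sumrB (perm_big _ (perm_to_rem tsq)) big_cons /=.
  have [k1 t20 _] := sqP _ tsq; rewrite rmorphM /= ks // (chiE _ t20) mulrCA subrr add0r.
  rewrite !big_seq; apply: eq_bigr => u /mem_rem /sqP[u1 u20 _].
  by rewrite rmorphM /= ks // (chiE _ u20); field.
by move=> /mapP[u /mem_rem usq ->] /= h; exists u.
Qed.

End Kummer.

(** * Cohomology of the cyclotomic extension *)

Section Cyclotomic.
Variables (p n : nat) (p_prime : prime p) (p_odd : odd p) (n_gt0 : (0 < n)%N).
Variables (F : fieldType) (L : closedFieldType) (iota : {rmorphism F -> L}).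
Hypothesis L_alg : forall x : L, algebraicOver iota x.
Local Notation q := (p ^ n)%N.
Local Notation F0 := (subfield_image iota).
Local Notation M := (cyclotomic_subfield iota q).
Variables (z : L) (z_prim : q.-primitive_root z).
Implicit Types (s t : aut L) (c x y b : L).

Lemma subfield_image_mem a : iota a \in F0.
Proof. by apply/asboolP; exists a. Qed.

Lemma cyclotomic_base a : iota a \in M.
Proof. by apply: mem_subfield_gen; left; exists a. Qed.

Lemma cyclotomic_mu w : w ^+ q = 1 -> w \in M.
Proof. by move=> wq; apply: mem_subfield_gen; right. Qed.

Lemma cyclotomic_zeta : z \in M.
Proof. exact/cyclotomic_mu/prim_expr_order. Qed.

Lemma image_sub_cyclotomic : {subset F0 <= M}.
Proof. by move=> _ /asboolP[a <-]; apply: cyclotomic_base. Qed.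

(** The values of polynomials at z form a ring, hence a field, containing F and mu_q. So an
    automorphism over F0 is determined on M by its value at z. *)
Lemma cyclotomic_poly x : x \in M -> exists g : {poly F0}, x = (map_poly val g).[z].
Proof.
pose S : {pred L} := fun x => `[< exists g : {poly F0}, x = (map_poly val g).[z] >].
have cl : divring_closed S.
  apply: (algebraic_subring_divring L_alg) => [|a].
    split; first by apply/asboolP; exists 1; rewrite rmorph1 hornerC.
      move=> _ _ /asboolP[f ->] /asboolP[g ->]; apply/asboolP; exists (f - g).
      by rewrite rmorphB hornerD hornerN.
    move=> _ _ /asboolP[f ->] /asboolP[g ->]; apply/asboolP; exists (f * g).
    by rewrite rmorphM hornerM.
  apply/asboolP; exists (SubfieldElt (subfield_image_mem a))%:P.
  by rewrite (map_polyC (val : F0 -> L)) hornerC.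
suff sub : {subset M <= Subfield cl} by move=> /sub/asboolP.
apply: subfield_gen_sub => a [[f _ <-]|/(prim_rootP z_prim)[i ->]]; apply/asboolP.
  exists (SubfieldElt (subfield_image_mem f))%:P.
  by rewrite (map_polyC (val : F0 -> L)) hornerC.
by exists 'X^i; rewrite (map_polyXn (val : F0 -> L)) hornerXn.
Qed.

Lemma q_neq0 (K : subfield L) : q%:R != 0 :> K.
Proof. by rewrite -(fmorph_eq0 (val : K -> L)) rmorph_nat (prim_root_natf_neq0 z_prim). Qed.

Lemma cyclotomic_fixed x : x \in M -> (forall s, fixing F0 s -> s x = x) -> x \in F0.
Proof.
move=> /cyclotomic_poly[g Ex].
apply: (simple_fixed L_alg subfield_image_mem (f := 'X^q - 1%:P) _ _ Ex).
  by apply: separable_Xn_sub_C (oner_neq0 _); apply: q_neq0.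
have -> : map_poly val ('X^q - 1%:P : {poly F0}) = 'X^q - 1%:P :> {poly L}.
  rewrite rmorphB; congr (_ - _); first exact: map_polyXn.
  by rewrite polyC1 rmorph1.
by rewrite /root !hornerE prim_expr_order ?subrr.
Qed.

Lemma cyclotomic_stable s x : fixing F0 s -> x \in M -> s x \in M.
Proof.
move=> sF; apply: subfield_gen_stable => a [[f _ <-]|aq].
  by rewrite sF ?subfield_image_mem // cyclotomic_base.
by apply: cyclotomic_mu; rewrite -rmorphXn /= aq rmorph1.
Qed.

Lemma cyclotomic_aut_eq s t x : fixing F0 s -> fixing F0 t -> s z = t z ->
  x \in M -> s x = t x.
Proof.
by move=> sF tF st /cyclotomic_poly[g ->]; rewrite !fixing_horner // st.
Qed.

Lemma fixing_sub s : fixing M s -> fixing F0 s.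
Proof. by move=> sM x /image_sub_cyclotomic; apply: sM. Qed.

Lemma fixing_cyclotomic s : fixing F0 s -> s z = z -> fixing M s.
Proof. by move=> sF sz x Mx; rewrite (cyclotomic_aut_eq (t := 1%g) sF _ sz Mx). Qed.

(** Identifies the additive group Z/q with mu_q; automorphisms over F0 become multiplication by
    units, and norms and coboundaries become linear maps. *)
Definition zexp (x : 'Z_q) : L := z ^+ x.

Let q_gt1 : (1 < q)%N := prime_power_gt1 p_prime n_gt0.

Lemma zexp_nat (i : nat) : zexp i%:R = z ^+ i.
Proof. by rewrite /zexp val_Zp_nat // prim_expr_mod. Qed.

Lemma zexp1 : zexp 1 = z.
Proof. by rewrite -[1]/(1%:R : 'Z_q) zexp_nat expr1. Qed.

Lemma zexpD (x y : 'Z_q) : zexp (x + y) = zexp x * zexp y.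
Proof. by rewrite -[x]natr_Zp -[y]natr_Zp -natrD !zexp_nat exprD. Qed.

Lemma zexpM (x y : 'Z_q) : zexp (x * y) = zexp x ^+ y.
Proof. by rewrite -{1}[x]natr_Zp -{1}[y]natr_Zp -natrM zexp_nat exprM. Qed.

Lemma zexp_eq1 (x : 'Z_q) : zexp x = 1 -> x = 0.
Proof.
rewrite -[x]natr_Zp zexp_nat => /eqP; rewrite -(prim_order_dvd z_prim).
by rewrite -(Zq_nat_eq0 p_prime n_gt0) => /eqP.
Qed.

Lemma zexp_neq0 (x : 'Z_q) : zexp x != 0.
Proof.
apply/negP => /eqP e; have := zexpD x (- x); rewrite subrr e mul0r.
by rewrite -[0]/(0%:R : 'Z_q) zexp_nat expr0 => /eqP; rewrite oner_eq0.
Qed.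

Lemma zexpX (x : 'Z_q) : zexp x ^+ q = 1.
Proof. by rewrite /zexp exprAC (prim_expr_order z_prim) expr1n. Qed.

Lemma zexpP (w : L) : w ^+ q = 1 -> exists i : 'Z_q, w = zexp i.
Proof. by move=> /(prim_rootP z_prim)[i ->]; exists i%:R; rewrite zexp_nat. Qed.

Lemma zexp_inj : injective zexp.
Proof.
move=> x y e; apply/eqP; rewrite -subr_eq0; apply/eqP/zexp_eq1.
apply: (mulIf (zexp_neq0 y)); by rewrite -zexpD subrK mul1r.
Qed.

(** The exponent is invertible because the inverse automorphism supplies its inverse. *)
Lemma aut_zexp s : fixing F0 s -> exists u : {unit 'Z_q}, s z = zexp (val u).
Proof.
move=> sF; have [|i Ei] := @zexpP (s z).
  by rewrite -rmorphXn (prim_expr_order z_prim) rmorph1.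
have [|j Ej] := @zexpP ((s^-1)%g z); first by rewrite -rmorphXn (prim_expr_order z_prim) rmorph1.
have ij : i * j = 1.
  apply: zexp_inj; rewrite zexpM -Ei -rmorphXn.
  transitivity z; last by rewrite zexp1.
  by rewrite -[RHS](autVK s z); congr (s _); rewrite Ej.
have Ui : i \is a GRing.unit by apply/unitrP; exists j; rewrite mulrC ij.
by exists (FinRing.unit 'Z_q Ui).
Qed.

Lemma aut_zexpM s (u x : 'Z_q) : s z = zexp u -> s (zexp x) = zexp (u * x).
Proof. by move=> sz; rewrite zexpM -sz -rmorphXn. Qed.

(** The exponents realised by Aut(L/F0) form a subgroup of the units of Z/q, which is cyclic as p is
    odd; t realises a generator. *)
Lemma cyclotomic_generator : exists t, exists u : {unit 'Z_q},
  [/\ fixing F0 t, t z = zexp (val u)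
    & forall s, fixing F0 s -> exists i, forall x, x \in M -> s x = (t ^+ i)%g x].
Proof.
pose D := [set u : {unit 'Z_q} | `[< exists2 s, fixing F0 s & s z = zexp (val u) >]].
have DP u : reflect (exists2 s, fixing F0 s & s z = zexp (val u)) (u \in D).
  by rewrite finset.in_set; apply: asboolP.
have gD : group_set D.
  apply/group_setP; split.
    by apply/DP; exists 1%g; rewrite // -[RHS]/(zexp 1) zexp1.
  move=> u v /DP[s sF sz] /DP[t tF tz]; apply/DP.
  exists (t * s)%g; first exact: fixingM.
  rewrite -[LHS]/(t (s z)) sz (aut_zexpM _ tz); congr zexp.
  by rewrite FinRing.val_unitM; apply: mulrC.
have cD : cyclic (fingroup.Group gD).
  apply: cyclicS (units_Zp_odd_prime_power_cyclic p_prime p_odd n_gt0).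
  by apply/fintype.subsetP => u _; rewrite inE.
have /cyclicP[u Du] := cD; rewrite /= in Du.
have /DP[t tF tz] : u \in D by rewrite Du cycle_id.
 exists t, u; split=> // s sF.
have tX i : (t ^+ i)%g z = zexp (val (u ^+ i)%g).
  elim: i => [|i IHi]; first by rewrite -[RHS]/(zexp 1) zexp1.
  by rewrite autXS IHi (aut_zexpM _ tz); congr zexp; rewrite expgS FinRing.val_unitM.
have [v sz] := aut_zexp sF; have : v \in D by apply/DP; exists s.
rewrite Du => /cycleP[i Ev]; exists i => x; apply: cyclotomic_aut_eq => //.
  exact: fixingX.
by rewrite sz Ev tX.
Qed.

(** * Hilbert 90 and the cohomology of mu_q for a cyclic group *)

Section Generator.
Variables (t : aut L) (u : {unit 'Z_q}).
Hypotheses (tF : fixing F0 t) (tz : t z = zexp (val u)).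
Local Notation d := #[u]%g.

Lemma autX_zexp i (x : 'Z_q) : (t ^+ i)%g (zexp x) = zexp (val u ^+ i * x).
Proof.
elim: i => [|i IHi]; first by rewrite expr0 mul1r.
by rewrite autXS IHi (aut_zexpM _ tz) mulrA -exprS.
Qed.

(** On mu_q the norm is multiplication by the sum studied in [unit_sum_structure]. *)
Lemma norm_zexp (x : 'Z_q) :
  \prod_(i < d) (t ^+ i)%g (zexp x) = zexp ((\sum_(i < d) val u ^+ i) * x).
Proof.
have zexp0 : zexp 0 = 1 by rewrite -[0]/(0%:R : 'Z_q) zexp_nat expr0.
rewrite mulr_suml (big_morph zexp zexpD zexp0).
by apply: eq_bigr => i _; rewrite autX_zexp.
Qed.

Lemma autX_order : fixing M (t ^+ d)%g.
Proof.
apply: fixing_cyclotomic; first exact: fixingX.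
by rewrite -{1}zexp1 autX_zexp mulr1 -FinRing.val_unitX expg_order -[RHS]zexp1.
Qed.

(** Here x may lie outside M: for b with b^q in M, the norm of t b / b is t^d b / b, possibly a
    nontrivial root of unity. *)
Lemma norm_telescope k x : x != 0 ->
  \prod_(i < k) (t ^+ i)%g (t x / x) = (t ^+ k)%g x / x.
Proof.
move=> x0; elim: k => [|k IHk]; first by rewrite big_ord0 divff.
rewrite big_ord_recr /= IHk fmorph_div /= mulrC mulrA.
have -> : (t ^+ k)%g (t x) = (t ^+ k.+1)%g x by rewrite expgSr.
by rewrite divfK // fmorph_eq0.
Qed.

(* y is a sum of twisted conjugates of a power of z; if these sums all vanished,
   so would the one obtained from a polynomial separating the conjugates of z. *)
Lemma hilbert90 c : c \in M -> c != 0 -> \prod_(i < d) (t ^+ i)%g c = 1 ->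
  exists y, [/\ y \in M, y != 0 & t y = y / c].
Proof.
move=> Mc c0 Nc; pose C i := \prod_(j < i) (t ^+ j)%g c.
pose Y (w : L) := \sum_(i < d) C i * (t ^+ i)%g w.
have MtX i x : x \in M -> (t ^+ i)%g x \in M by apply: cyclotomic_stable; apply: fixingX.
have MC i : C i \in M by apply: rpred_prod => j _; apply: MtX.
have tY w : w \in M -> c * t (Y w) = Y w.
  move=> Mw; pose G i := C i * (t ^+ i)%g w.
  (* Applying t and multiplying by c shifts the index; the shift is cyclic because c has norm 1 and
     t^d fixes w. *)
  have -> : c * t (Y w) = \sum_(i < d) G i.+1.
    rewrite rmorph_sum mulr_sumr; apply: eq_bigr => i _.
    rewrite rmorphM /= mulrA /G autXS; congr (_ * _).
    rewrite /C big_ord_recl rmorph_prod; congr (_ * _).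
    by apply: eq_bigr => j _; rewrite lift0 autXS.
  have Gd : G d = G 0%N by rewrite /G /C Nc big_ord0 (autX_order Mw).
  exact: sum_shift.
have [l Yl] : exists l, Y (z ^+ l) != 0.
  apply: contrapT => /forallNP Y0.
  have Yf (f : {poly L}) : \sum_(i < d) C i * f.[(t ^+ i)%g z] = 0.
    under eq_bigr => i _ do rewrite horner_coef mulr_sumr.
    rewrite exchange_big /= big1 // => l _.
    transitivity (f`_l * Y (z ^+ l)); last first.
      by have /negP/negPn/eqP -> := Y0 l; rewrite mulr0.
    by rewrite mulr_sumr; apply: eq_bigr => i _; rewrite rmorphXn /= mulrCA.
  have d_gt0 : (0 < d)%N := fingroup.order_gt0 u.
  pose i0 := Ordinal d_gt0.
  (* Only the term of index 0 survives for this polynomial, so its value at z is 0 and z = t^i z for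
     some 0 < i < d, against the order of u. *)
  have := Yf (\prod_(i < d | i != i0) ('X - ((t ^+ i)%g z)%:P)).
  rewrite (bigD1 i0) //= [X in _ + X]big1 => [|i ii0]; last first.
    by rewrite horner_prod (bigD1 i) //= hornerXsubC subrr mul0r mulr0.
  rewrite addr0 /C big_ord0 mul1r horner_prod => /eqP; rewrite prodf_seq_eq0.
  case/hasP => i _ /andP[ii0]; rewrite hornerXsubC subr_eq0 => /eqP ez.
  have /zexp_inj e : zexp 1 = zexp (val u ^+ i).
    by rewrite -[val u ^+ i]mulr1 -autX_zexp zexp1.
  case/negP: ii0.
  have : (u ^+ i == 1)%g by rewrite -val_eqE /= FinRing.val_unitX -e.
  rewrite -order_dvdn => di; apply/eqP/val_inj => /=; apply/eqP.
  by rewrite -leqn0 leqNgt; apply/negP => i_gt0; have := dvdn_leq i_gt0 di; rewrite leqNgt ltn_ord.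
exists (Y (z ^+ l)); split=> //.
  by apply: rpred_sum => i _; apply: rpredM => //; apply/MtX/rpredX/cyclotomic_zeta.
by apply: (mulfI c0); rewrite tY ?rpredX ?cyclotomic_zeta // mulrC divfK.
Qed.

Hypothesis t_gen : forall s, fixing F0 s ->
  exists i, forall x, x \in M -> s x = (t ^+ i)%g x.

Lemma cyclotomic_fixed_generator x : x \in M -> t x = x -> x \in F0.
Proof.
move=> Mx tx; apply: cyclotomic_fixed => // s /t_gen[i ->] //.
by elim: i => // i IHi; rewrite autXS IHi.
Qed.

(* The vanishing of H^1(Gal(M/F), mu_q). *)
Lemma cyclotomic_power x : x \in M -> x ^+ q \in F0 ->
  exists2 y, y \in F0 & x ^+ q = y ^+ q.
Proof.
move=> Mx Fx; have [->|x0] := eqVneq x 0; first by exists 0; rewrite ?rpred0.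
have [w Ew] : exists w : 'Z_q, t x / x = zexp w.
  by apply: zexpP; rewrite expr_div_n -rmorphXn /= tF // divff // expf_neq0.
(* As t x / x has norm 1, w = (u - 1) v: it is also the coboundary of [zexp v], and x / [zexp v] is
   fixed by t. *)
have /zexp_eq1/(unit_sum_ker p_prime p_odd n_gt0)[v Ev] :
    zexp ((\sum_(i < d) val u ^+ i) * w) = 1.
  by rewrite -norm_zexp -Ew norm_telescope // (autX_order Mx) divff.
have tv : t (zexp v) = zexp w * zexp v.
  by rewrite -zexpD Ev mulrBl mul1r subrK -(autX_zexp 1) expg1.
exists (x / zexp v); last by rewrite expr_div_n zexpX divr1.
apply: cyclotomic_fixed_generator.
  by apply: rpred_div => //; apply/cyclotomic_mu/zexpX.
rewrite fmorph_div /= tv -Ew; field.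
by rewrite x0 zexp_neq0 fmorph_eq0 x0.
Qed.

(* The norm of c = t b / b is a root of unity fixed by t, hence the norm of a root
   of unity since the Tate group H^0(Gal(M/F), mu_q) vanishes; after division by
   it, c is a coboundary by Hilbert 90. *)
Lemma cyclotomic_descent b : b != 0 -> b ^+ q \in M -> t b / b \in M ->
  exists y, [/\ y \in M, y != 0 & (b / y) ^+ q \in F0].
Proof.
move=> b0 Mb Mc; pose c := t b / b.
have c0 : c != 0 by rewrite mulf_neq0 ?invr_eq0 ?fmorph_eq0.
have [w Ew] : exists w : 'Z_q, (t ^+ d)%g b / b = zexp w.
  by apply: zexpP; rewrite expr_div_n -rmorphXn /= (autX_order Mb) divff // expf_neq0.
have tw : t (zexp w) = zexp w.
  have tdc : (t ^+ d)%g c = c by apply: autX_order.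
  rewrite -Ew -(norm_telescope d b0) rmorph_prod -/c.
  apply: (mulfI c0); rewrite -{1}[c]/((t ^+ 0)%g c).
  (* The product of d + 1 consecutive conjugates of c is split at either end; the end factors agree
     since t^d c = c. *)
  transitivity (\prod_(i < d.+1) (t ^+ i)%g c).
    by rewrite big_ord_recl; congr (_ * _); apply: eq_bigr => i _; rewrite lift0 autXS.
  by rewrite big_ord_recr /= tdc mulrC.
have /(unit_sum_fixed p_prime p_odd n_gt0)[v Ev] : (val u - 1) * w = 0.
  apply: zexp_eq1; apply: (mulIf (zexp_neq0 w)).
  by rewrite -zexpD mulrBl mul1r subrK mul1r -{1}[val u]expr1 -autX_zexp expg1.
have Mv : zexp v \in M by apply/cyclotomic_mu/zexpX.
have [|||y [My y0 ty]] := @hilbert90 (c / zexp v).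
- exact: rpred_div.
- by rewrite mulf_neq0 ?invr_eq0 ?zexp_neq0.
- under eq_bigr do rewrite fmorph_div /=.
  by rewrite prodf_div norm_zexp -Ev norm_telescope // Ew divff ?zexp_neq0.
(* With t y = y / (c / [zexp v]), t multiplies b y by the root of unity [zexp v] and so fixes its
   q-th power. *)
exists y^-1; split; rewrite ?rpredV ?invr_eq0 // invrK.
apply: cyclotomic_fixed_generator; first by rewrite exprMn; apply: rpredM => //; apply: rpredX.
have tb : t b = c * b by rewrite divfK.
rewrite rmorphXn rmorphM /= ty tb.
have -> : c * b * (y / (c / zexp v)) = zexp v * (b * y).
  by field; rewrite c0 zexp_neq0.
by rewrite exprMn zexpX mul1r.
Qed.

End Generator.

End Cyclotomic.

(** * Generation of abelian extensions by radicals *)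

Section KummerGeneration.
Variables (F : fieldType) (L : closedFieldType) (iota : {rmorphism F -> L}).
Hypothesis L_alg : forall x : L, algebraicOver iota x.
Variables (m : nat) (z : L) (z_prim : m.-primitive_root z) (k K : subfield L).
Hypotheses (kF : forall a, iota a \in k) (kz : z \in k) (KG : galois_ext K k).
Hypothesis K_abelian : forall s t : aut L, fixing k s -> fixing k t ->
  forall x, x \in K -> s (t x) = t (s x).
Hypothesis K_exponent : forall s : aut L, fixing k s ->
  forall x, x \in K -> (s ^+ m)%g x = x.

Let m_gt0 : (0 < m)%N := prim_order_gt0 z_prim.
Let m0 : m%:R != 0 :> L := prim_root_natf_neq0 z_prim.
Let z0 : z != 0.
Proof.
by apply/eqP => e; have /eqP := prim_expr_order z_prim; rewrite e expr0n gtn_eqF // eq_sym oner_eq0.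
Qed.

(* Projection onto the eigenspace of h for the eigenvalue z ^+ j: over k, the
   operator h is annihilated by 'X^m - 1, which splits with distinct roots. *)
Definition eigenproj (h : aut L) (j : nat) (v : L) : L :=
  m%:R^-1 * \sum_(i < m) z^-1 ^+ (i * j) * (h ^+ i)%g v.

Lemma eigenproj_mem h j v : fixing k h -> v \in K -> eigenproj h j v \in K.
Proof.
move=> kh Kv; have kK : {subset k <= K} by case: KG.
apply: rpredM; first by rewrite rpredV rpred_nat.
apply: rpred_sum => i _; apply: rpredM; first by rewrite rpredX // rpredV kK.
exact: (galois_stable L_alg kF KG (fixingX _ kh) Kv).
Qed.

Lemma eigenproj_scale h j (c v : L) : fixing k h -> c \in k ->
  eigenproj h j (c * v) = c * eigenproj h j v.
Proof.
move=> kh kc; rewrite /eigenproj mulrCA; congr (_ * _); rewrite mulr_sumr.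
by apply: eq_bigr => i _; rewrite rmorphM /= (fixingX _ kh) // mulrCA.
Qed.

Lemma eigenproj_comm g h j v : fixing k g -> fixing k h -> v \in K ->
  g (eigenproj h j v) = eigenproj h j (g v).
Proof.
move=> kg kh Kv; rewrite /eigenproj rmorphM /= rmorph_sum /=.
rewrite fmorphV rmorph_nat; congr (_ * _); apply: eq_bigr => i _.
rewrite rmorphM /= (K_abelian kg (fixingX _ kh) Kv); congr (_ * _).
by rewrite kg // rpredX // rpredV.
Qed.

(** Applying h shifts the summation index, and the summands are periodic because z^m = 1 and h^m
    fixes v. *)
Lemma eigenprojP h j v : fixing k h -> v \in K ->
  h (eigenproj h j v) = z ^+ j * eigenproj h j v.
Proof.
move=> kh Kv; pose G i := z^-1 ^+ (i * j) * (h ^+ i)%g v.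
have Gm : G m = G 0%N.
  by rewrite /G K_exponent // mul0n expr0 exprM exprVn (prim_expr_order z_prim) invr1 expr1n.
rewrite /eigenproj mulrCA rmorphM /= rmorph_sum /= fmorphV rmorph_nat; congr (_ * _).
rewrite -[in RHS](sum_shift Gm) mulr_sumr; apply: eq_bigr => i _; rewrite /G rmorphM /= autXS mulrA.
rewrite kh ?rpredX ?rpredV //; congr (_ * _); rewrite mulSn exprD mulrA.
by rewrite -exprMn divff // expr1n mul1r.
Qed.

(** Orthogonality of characters: the sum over j of z^(-ij) is m for i = 0 and vanishes for 0 < i <
    m. *)
Lemma sum_eigenproj h v : v = \sum_(j < m) eigenproj h j v.
Proof.
rewrite -mulr_sumr exchange_big /=.
under eq_bigr => i _ do rewrite -mulr_suml.
pose i0 := Ordinal m_gt0; rewrite (bigD1 i0) //= [X in _ + X]big1 => [|i ii0].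
  rewrite addr0; under eq_bigr do rewrite mul0n expr0.
  by rewrite sumr_const card_ord mulKf.
have -> : \sum_(j < m) z^-1 ^+ (i * j) = 0; last by rewrite mul0r.
have zi : z^-1 ^+ i - 1 != 0.
  rewrite subr_eq0 exprVn -[1]invr1 (inj_eq invr_inj) -(prim_order_dvd z_prim).
  apply: contra ii0 => mi; rewrite -val_eqE /= -leqn0 leqNgt; apply/negP => i_gt0.
  by have := dvdn_leq i_gt0 mi; rewrite leqNgt ltn_ord.
apply: (mulfI zi); under eq_bigr do rewrite exprM.
rewrite -subrX1 mulr0 -exprM mulnC exprM exprVn (prim_expr_order z_prim) invr1 expr1n.
by rewrite subrr.
Qed.

(** Each new h splits every vector into eigenvectors; since the projections commute with Aut(L/k) on
    K, earlier eigenvalues survive, and so does the middle clause, by which the value of an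
    automorphism at x determines its value at v. *)
Lemma simultaneous_eigen x (hs : seq (aut L)) : x \in K ->
  (forall h, h \in hs -> fixing k h) ->
  exists2 vs : seq L, x = \sum_(v <- vs) v & forall v, v \in vs ->
    [/\ v \in K,
        (forall g g', fixing k g -> fixing k g' -> g x = g' x -> g v = g' v)
      & forall h, h \in hs -> exists j, h v = z ^+ j * v].
Proof.
move=> Kx; elim: hs => [|h hs IHhs] hsk.
  by exists [:: x]; rewrite ?big_seq1 // => v; rewrite inE => /eqP ->; split.
have [|vs Ex vsP] := IHhs; first by move=> g ghs; apply: hsk; rewrite inE ghs orbT.
have kh : fixing k h by apply: hsk; rewrite mem_head.
exists [seq eigenproj h j v | v <- vs, j <- index_iota 0 m].
  rewrite big_allpairs_dep Ex; apply: eq_bigr => v _.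
  by rewrite {1}[v](sum_eigenproj h) -(big_mkord xpredT (fun j => eigenproj h j v)).
move=> _ /allpairsP[[v j] /= [vvs _ ->]]; have [Kv gv hv] := vsP v vvs.
split; first exact: eigenproj_mem.
  by move=> g g' kg kg' gg'; rewrite !eigenproj_comm // (gv g g').
move=> g; rewrite inE => /orP[/eqP ->|ghs]; first by exists j; apply: eigenprojP.
have [l gl] := hv _ ghs; exists l; rewrite eigenproj_comm ?gl ?eigenproj_scale ?rpredX //.
by apply: hsk; rewrite inE ghs orbT.
Qed.

(* An automorphism over k agrees on a simultaneous eigenvector v with whichever
   h of the finite list hs has the same value at x, so v ^+ m is fixed. *)
Lemma kummer_generation x : x \in K ->
  exists2 vs : seq L, x = \sum_(v <- vs) v &
    forall v, v \in vs -> v \in K /\ v ^+ m \in k.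
Proof.
move=> Kx; have [rs [_ _ _ rsP]] := galois_orbit L_alg kF KG Kx.
have [hs hsk hsP] : exists2 hs : seq (aut L), (forall h, h \in hs -> fixing k h) &
    forall y, y \in rs -> exists2 h, h \in hs & h x = y.
  have rsk y : y \in rs -> exists2 s, fixing k s & s x = y by move=> /rsP.
  elim: rs rsk {rsP} => [|y rs IHrs] rsk; first by exists [::].
  have [|hs hsk hsP] := IHrs; first by move=> w wrs; apply: rsk; rewrite inE wrs orbT.
  have [s ks sx] := rsk y (mem_head _ _); exists (s :: hs) => [h|w].
    by rewrite inE => /orP[/eqP ->|/hsk].
  rewrite inE => /orP[/eqP ->|/hsP[h hhs hx]]; first by exists s; rewrite ?mem_head.
  by exists h; rewrite // inE hhs orbT.
have [vs Ex vsP] := simultaneous_eigen Kx hsk; exists vs => // v /vsP[Kv gv hv].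
split=> //; apply: (galois_fixed L_alg kF KG) => [|s ks]; first exact: rpredX.
have [h hhs hx] : exists2 h, h \in hs & h x = s x by apply/hsP/rsP; exists s.
have [j hj] := hv h hhs; rewrite rmorphXn /= -(gv h s) ?hj //; last exact: hsk.
by rewrite exprMn exprAC (prim_expr_order z_prim) expr1n mul1r.
Qed.

End KummerGeneration.

(** * The correspondence *)

Lemma exponent_dvdP (G : groupType) (m : nat) : (0 < m)%N ->
  (forall s : G, (s ^+ m = 1)%g) -> exponent_dvd G m.
Proof.
move=> m_gt0 Gm; pose P d := (0 < d)%N && `[< forall s : G, (s ^+ d = 1)%g >].
have exP : exists d, P d by exists m; rewrite /P m_gt0; apply/asboolP.
case: (ex_minnP exP) => e /andP[e_gt0 /asboolP Ge] e_min; exists e.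
  by split=> // d d_gt0 Gd; apply: e_min; rewrite /P d_gt0; apply/asboolP.
rewrite /dvdn -leqn0 leqNgt; apply/negP => r_gt0.
have : (e <= m %% e)%N.
  apply: e_min; rewrite /P r_gt0; apply/asboolP => s.
  by have := Gm s; rewrite {1}(divn_eq m e) expgD mulnC expgM Ge expg1n mul1g.
by rewrite leqNgt ltn_mod e_gt0.
Qed.

Lemma exponent_dvd_expg (G : groupType) (m : nat) :
  exponent_dvd G m -> forall s : G, (s ^+ m = 1)%g.
Proof. by case=> e [_ Ge _] /dvdnP[c ->] s; rewrite mulnC expgM Ge expg1n. Qed.

Lemma val_galgrpX (L : fieldType) (K k : subfield L) (s : galgrp K k) i :
  val (s ^+ i)%g = (val s ^+ i)%g.
Proof. by elim: i => // i IHi; rewrite !expgS -IHi. Qed.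

Section Correspondence.
Variables (p n : nat) (p_prime : prime p) (p_odd : odd p) (n_gt0 : (0 < n)%N).
Variables (F : fieldType) (L : closedFieldType) (iota : {rmorphism F -> L}).
Hypothesis L_alg : forall x : L, algebraicOver iota x.
Local Notation q := (p ^ n)%N.
Local Notation F0 := (subfield_image iota).
Local Notation M := (cyclotomic_subfield iota q).
Variables (z : L) (z_prim : q.-primitive_root z).
Variable alpha : galgrp M F0 -> {unit 'Z_q}.
Hypothesis alphaP : is_cyclotomic_character alpha.

Let q_gt0 : (0 < q)%N := prim_order_gt0 z_prim.
Let q0 : q%:R != 0 :> L := prim_root_natf_neq0 z_prim.

(** All q-th roots of all representatives are taken, so that the set involves no choice and is
    stable under Aut(L/F0). *)
Definition radicals (U : set (powquot F q)) : set L :=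
  [set b | exists2 u : mulgrp F, U (powclass q u) & b ^+ q = iota (val u)]%classic.

Definition radical_ext (U : set (powquot F q)) : subfield L :=
  subfield_gen ([set x | x \in M] `|` radicals U)%classic.

(** * The extension attached to U: Galois property, exponent and action *)

Section RadicalExt.
Variable U : set (powquot F q).
Local Notation K := (radical_ext U).

Lemma radical_neq0 b : radicals U b -> b != 0.
Proof.
case=> u _ bu; apply/negP => /eqP b0; move: bu; rewrite b0 expr0n gtn_eqF //.
by move/esym/eqP; rewrite fmorph_eq0; apply/negP/(valP u).
Qed.

Lemma radical_expF b : radicals U b -> b ^+ q \in F0.
Proof. by case=> u _ ->; apply: subfield_image_mem. Qed.

Lemma radical_expM b : radicals U b -> b ^+ q \in M.
Proof. by move/radical_expF; apply: image_sub_cyclotomic. Qed.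

Lemma radical_conj b c : radicals U b -> c ^+ q = b ^+ q -> radicals U c.
Proof. by case=> u Uu bu cb; exists u; rewrite // cb. Qed.

Lemma sub_radical_ext : {subset M <= K}.
Proof. by move=> x Mx; apply: mem_subfield_gen; left. Qed.

Lemma radical_mem b : radicals U b -> b \in K.
Proof. by move=> Ub; apply: mem_subfield_gen; right. Qed.

Lemma radical_ext_stable s : fixing F0 s -> forall x, x \in K -> s x \in K.
Proof.
move=> sF; apply: subfield_gen_stable => b [Mb|Ub].
  by apply: sub_radical_ext; apply: (cyclotomic_stable sF Mb).
apply: radical_mem; apply: (radical_conj Ub).
by rewrite -rmorphXn /= sF // radical_expF.
Qed.

Hypothesis U_group : group_closed (mem U).

(** As U is a group, products of radicals are radicals; their M-combinations form a ring, hence a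
    field. *)
Lemma radical_ext_span x : x \in K -> exists2 sq : seq (L * L),
  x = \sum_(t <- sq) t.1 * t.2 &
  forall t, t \in sq -> t.1 \in M /\ radicals U t.2.
Proof.
have U1 : U (powclass q 1%g) by case: U_group => /set_mem.
have UM v w : U (powclass q v) -> U (powclass q w) -> U (powclass q (v * w)%g).
  move=> Uv Uw; rewrite -powquotME; apply: set_mem.
  by apply: (group_closedM U_group); apply: mem_set.
have R1 : radicals U 1 by exists 1%g; rewrite ?expr1n ?rmorph1.
have RM a b : radicals U a -> radicals U b -> radicals U (a * b).
  case=> v Uv av [w Uw bw]; exists (v * w)%g; first exact: UM.
  by rewrite exprMn av bw -rmorphM.
pose S : {pred L} := fun x => `[< exists2 sq : seq (L * L),
  x = \sum_(t <- sq) t.1 * t.2 & forall t, t \in sq -> t.1 \in M /\ radicals U t.2 >].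
have SM a : a \in M -> a \in S.
  move=> Ma; apply/asboolP; exists [:: (a, 1)]; first by rewrite big_seq1 mulr1.
  by move=> t; rewrite inE => /eqP ->.
have cl : divring_closed S.
  apply: (algebraic_subring_divring L_alg) => [|a]; last exact/SM/cyclotomic_base.
  split; first by apply: SM; apply: rpred1.
    move=> _ _ /asboolP[sa -> sa_in] /asboolP[sb -> sb_in]; apply/asboolP.
    exists (sa ++ [seq (- t.1, t.2) | t <- sb]).
      rewrite big_cat big_map /= -sumrN; congr (_ + _).
      by apply: eq_bigr => t _; rewrite mulNr.
    move=> t; rewrite mem_cat => /orP[/sa_in //|/mapP[v /sb_in[v1 v2] ->]].
    by rewrite rpredN.
  move=> _ _ /asboolP[sa -> sa_in] /asboolP[sb -> sb_in]; apply/asboolP.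
  exists [seq (v.1 * w.1, v.2 * w.2) | v <- sa, w <- sb].
    rewrite big_allpairs_dep mulr_suml; apply: eq_bigr => v _.
    by rewrite mulr_sumr; apply: eq_bigr => w _; rewrite mulrACA.
  move=> _ /allpairsP[[v w] [/sa_in[v1 v2] /sb_in[w1 w2] ->]].
  by split; [exact: (rpredM v1 w1) | exact: RM].
suff sub : {subset K <= Subfield cl} by move=> /sub/asboolP.
apply: subfield_gen_sub => b [/SM //|Ub]; apply/asboolP.
exists [:: (1, b)]; first by rewrite big_seq1 mul1r.
by move=> t; rewrite inE => /eqP ->; split=> //; apply: rpred1.
Qed.

(** [kummer_eigen] applied to a spanning sum. Both the computation of the fixed field and
    injectivity rest on it. *)
Lemma radical_ext_eigen x : x \in K -> x != 0 ->
  (forall s, fixing M s -> s x / x \in M) ->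
  exists2 b, radicals U b & x / b \in M.
Proof.
move=> Kx x0 xM; have [sq Ex sqP] := radical_ext_span Kx.
have [|t /sqP[_ Ut] xt] := kummer_eigen L_alg q0 (cyclotomic_base p n iota)
  (@cyclotomic_mu p n F L iota) (sq := sq) _ Ex x0 xM.
  by move=> t /sqP[t1 t2]; split; rewrite ?radical_neq0 ?radical_expM.
by exists t.2.
Qed.

(** A nonzero fixed x is an M-multiple of a radical b; then b is fixed too, so lies in M by
    [kummer_root_fixed], and x with it. *)
Lemma radical_ext_fixedM x : x \in K -> (forall s, fixing M s -> s x = x) -> x \in M.
Proof.
move=> Kx xfix; have [->|x0] := eqVneq x 0; first exact: rpred0.
have [|b Ub xb] := radical_ext_eigen Kx x0.
  by move=> s /xfix ->; rewrite divff // rpred1.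
have b0 := radical_neq0 Ub.
suff Mb : b \in M by rewrite -[x](divfK b0); apply: rpredM.
have -> : b = x / (x / b) by field; rewrite x0 b0.
apply: (kummer_root_fixed L_alg q0 (cyclotomic_base p n iota)) => [|s sM].
  by rewrite invf_div mulrCA divff // mulr1 radical_expM.
by rewrite fmorph_div /= xfix // sM.
Qed.

Lemma radical_ext_galois (k : subfield L) : (forall a, iota a \in k) ->
  {subset k <= K} -> (forall x, x \in K -> (forall s, fixing k s -> s x = x) -> x \in k) ->
  galois_ext K k.
Proof.
move=> kF kK fixk; apply: (galois_ext_of_fixed L_alg kF kK) => // s ks.
by apply: radical_ext_stable => _ /asboolP[a <-]; apply: ks.
Qed.

Lemma radical_ext_galoisM : galois_ext K M.
Proof.
apply: radical_ext_galois; last exact: radical_ext_fixedM.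
  exact: cyclotomic_base.
exact: sub_radical_ext.
Qed.

Lemma radical_ext_galoisF : galois_ext K F0.
Proof.
apply: radical_ext_galois => [a|x F0x|x Kx xfix].
- exact: subfield_image_mem.
- by apply: sub_radical_ext; apply: image_sub_cyclotomic.
apply: (cyclotomic_fixed L_alg z_prim) => //; apply: radical_ext_fixedM => // s.
by move=> /fixing_sub; apply: xfix.
Qed.

Lemma autfM (E : fieldType) (s : aut E) a b : s (a * b) = s a * s b.
Proof. exact: rmorphM. Qed.

Lemma autfX (E : fieldType) (s : aut E) a i : s (a ^+ i) = s a ^+ i.
Proof. exact: rmorphXn. Qed.

Lemma galgrp_fixes (k : subfield L) (s : galgrp K k) (a : K) :
  val a \in k -> val s a = a.
Proof. by move=> ka; have /asboolP := valP s; apply. Qed.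

Lemma galgrp_radical (s : galgrp K M) (a : K) : radicals U (val a) ->
  exists w : K, [/\ val w \in M, w ^+ q = 1 & val s a = w * a].
Proof.
move=> Ua; have a0 : a != 0 by rewrite -(fmorph_eq0 (val : K -> L)) radical_neq0.
exists (val s a / a); rewrite divfK //.
have e : (val s a / a) ^+ q = 1.
  have Ma : val (a ^+ q) \in M by rewrite rmorphXn radical_expM.
  rewrite expr_div_n; have -> : val s a ^+ q = a ^+ q.
    by rewrite -[RHS](galgrp_fixes s Ma) rmorphXn.
  by rewrite divff ?expf_neq0.
split=> //; apply: cyclotomic_mu.
by rewrite -rmorphXn e rmorph1.
Qed.

Lemma galgrp_radicalX (s : galgrp K M) (a w : K) i : val w \in M -> val s a = w * a ->
  (val s ^+ i)%g a = w ^+ i * a.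
Proof.
move=> Mw sa; elim: i => [|i IHi]; first by rewrite mul1r.
rewrite expgS -[LHS]/(val s ((val s ^+ i)%g a)) IHi autfM autfX.
by rewrite (galgrp_fixes s Mw) sa mulrA -exprSr.
Qed.

Lemma galgrp_fixesX (s : galgrp K M) (a : K) i : val a \in M ->
  (val s ^+ i)%g a = a.
Proof.
move=> Ma; elim: i => // i IHi.
by rewrite expgS -[LHS]/(val s ((val s ^+ i)%g a)) IHi galgrp_fixes.
Qed.

Lemma radical_ext_abelian : is_abelian (galgrp K M).
Proof.
move=> s t; apply: val_inj; apply: aut_subfield_gen_eq => a [Ma|Ua].
  rewrite -[LHS]/(val s (val t a)) -[RHS]/(val t (val s a)).
  by rewrite !(galgrp_fixes _ Ma).
have [v [Mv _ sa]] := galgrp_radical s Ua; have [w [Mw _ ta]] := galgrp_radical t Ua.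
rewrite -[LHS]/(val s (val t a)) -[RHS]/(val t (val s a)).
by rewrite ta sa !autfM (galgrp_fixes s Mw) (galgrp_fixes t Mv) sa ta mulrCA.
Qed.

Lemma radical_ext_exponent : exponent_dvd (galgrp K M) q.
Proof.
apply: exponent_dvdP => // s; apply: val_inj.
rewrite val_galgrpX.
apply: aut_subfield_gen_eq => a [Ma|Ua]; first exact: galgrp_fixesX.
have [w [Mw wq sa]] := galgrp_radical s Ua.
by rewrite (galgrp_radicalX _ Mw sa) wq mul1r.
Qed.

(** On M both sides are the identity. For a radical a and b = T^-1 a, the ratio a / b is in mu_q, so
    S has the same eigenvalue w at a and b, and T S T^-1 a = T(w) a with T(w) = w^(alpha g). *)
Lemma radical_ext_acts : acts_via K alpha.
Proof.
move=> g s t tg; apply: aut_subfield_gen_eq => a Aa.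
set T := val t; set S := val s.
have TK (b : K) : T ((T^-1)%g b) = b by rewrite -[LHS]/((T * T^-1)%g b) mulgV.
have Tinj : injective T by apply: fmorph_inj.
rewrite -[(T * S * T^-1)%g a]/(T (S ((T^-1)%g a))).
set b := (T^-1)%g a; case: Aa => [Ma|Ua].
  pose y : M := (val g^-1)%g (SubfieldElt Ma : M).
  have Tb : T (SubfieldElt (sub_radical_ext (valP y))) = a.
    apply: val_inj; rewrite (tg _ y) // /y.
    by rewrite -[X in val X]/((val g * (val g)^-1)%g (SubfieldElt Ma)) mulgV.
  have Mb : val b \in M.
    suff -> : b = SubfieldElt (sub_radical_ext (valP y)) by apply: valP y.
    by apply: Tinj; rewrite Tb TK.
  by rewrite (galgrp_fixes s Mb) TK (galgrp_fixesX _ _ Ma).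
have ba : b ^+ q = a ^+ q.
  have Fa : val (a ^+ q) \in F0 by rewrite rmorphXn radical_expF.
  by apply: Tinj; rewrite (galgrp_fixes t Fa) autfX TK.
have Ub : radicals U (val b).
  by apply: (radical_conj Ua); have := congr1 val ba; rewrite !rmorphXn.
have b0 : b != 0 by rewrite -(fmorph_eq0 (val : K -> L)) radical_neq0.
have [w [Mw wq Sb]] := galgrp_radical s Ub.
have Sa : S a = w * a.
  have Mab : val (a / b) \in M.
    apply: cyclotomic_mu.
    have e : (a / b) ^+ q = 1 by rewrite expr_div_n -ba divff ?expf_neq0.
    by rewrite -rmorphXn e rmorph1.
  by rewrite -[a](divfK b0) autfM (galgrp_fixes s Mab) Sb mulrCA.
rewrite Sb autfM TK (galgrp_radicalX _ Mw Sa); congr (_ * _); apply: val_inj.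
pose y : M := SubfieldElt Mw; rewrite (tg w y) // alphaP; last first.
  by apply: val_inj; have := congr1 val wq; rewrite !rmorphXn !rmorph1.
by rewrite !rmorphXn.
Qed.

End RadicalExt.

(** * Injectivity of the correspondence *)

Lemma closed_nth_root (c : L) : exists b, b ^+ q = c.
Proof.
have /closed_rootP[b] : size ('X^q - c%:P : {poly L}) != 1 by rewrite size_XnsubC // eqSS -lt0n.
by rewrite /root !hornerE subr_eq0 => /eqP; exists b.
Qed.

(** A q-th root of u in U lies in the field of V, so it is an M-multiple of a q-th root of some v in
    V. Thus u / v is a q-th power in M, hence in F by [cyclotomic_power], and u and v have the same
    class. *)
Lemma radical_ext_sub (U V : set (powquot F q)) : group_closed (mem V) ->
  {subset radical_ext U <= radical_ext V} -> (U `<=` V)%classic.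
Proof.
move=> V_group UV x; have [u ->] := powclass_surj x => Uu.
have [b bu] := closed_nth_root (iota (val u)).
have Ub : radicals U b by exists u.
have b0 := radical_neq0 Ub.
have [s sM|c [v Vv cv] Mbc] := radical_ext_eigen V_group (UV _ (radical_mem Ub)) b0.
  by have [] := kummer_char (@cyclotomic_mu p n F L iota) sM b0 (radical_expM Ub).
have [t [w [tF tz tgen]]] := cyclotomic_generator p_prime p_odd n_gt0 L_alg z_prim.
have Ebc : (b / c) ^+ q = iota (val (u * v^-1)%g).
  by rewrite expr_div_n bu cv rmorphM fmorphV.
have [|y /asboolP[f <-]] := cyclotomic_power p_prime p_odd n_gt0 L_alg z_prim tF tz tgen Mbc.
  by rewrite Ebc subfield_image_mem.
rewrite Ebc -rmorphXn => /fmorph_inj Ef.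
have f0 : f != 0.
  apply/negP => /eqP f0; move: Ef; rewrite f0 expr0n gtn_eqF // => Ef.
  by have := valP (u * v^-1)%g; rewrite Ef eqxx.
have -> : powclass q u = powclass q v; last exact: Vv.
apply/eqP/powclassP; exists (Mulgrp f0).
have -> : (Mulgrp f0 ^+ q)%g = (u * v^-1)%g.
  apply: val_inj; rewrite Ef; elim: (q) => // i IHi.
  by rewrite expgS exprS -IHi.
by rewrite mulgrpC mulgVK.
Qed.

(** * Recovering an extension from the radicals it contains *)

Section Surjectivity.
Variable K : subfield L.
Hypotheses (KM : galois_ext K M) (K_abel : is_abelian (galgrp K M))
  (K_exp : exponent_dvd (galgrp K M) q) (KF : galois_ext K F0)
  (K_acts : acts_via K alpha).

Let MK : {subset M <= K}. Proof. by case: KM. Qed.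

Lemma restrict_expg (s : aut L) (s' : galgrp K M) i :
  (forall x : K, val (val s' x) = s (val x)) ->
  forall x : K, val ((val s' ^+ i)%g x) = (s ^+ i)%g (val x).
Proof.
by move=> ss'; elim: i => [|i IHi] x //; rewrite autXS -IHi -ss' expgS.
Qed.

Lemma target_abelian s t : fixing M s -> fixing M t ->
  forall x, x \in K -> s (t x) = t (s x).
Proof.
move=> sM tM x Kx.
have [s' ss'] := galois_restrict L_alg (cyclotomic_base p n iota) KM sM.
have [t' tt'] := galois_restrict L_alg (cyclotomic_base p n iota) KM tM.
have e : val s' (val t' (SubfieldElt Kx)) = val t' (val s' (SubfieldElt Kx)).
  by rewrite -[LHS]/((val (s' * t')%g) (SubfieldElt Kx)) (K_abel s' t').
by have := congr1 val e; rewrite !(ss', tt').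
Qed.

Lemma target_exponent s : fixing M s -> forall x, x \in K -> (s ^+ q)%g x = x.
Proof.
move=> sM x Kx; have [s' ss'] := galois_restrict L_alg (cyclotomic_base p n iota) KM sM.
rewrite -[x]/(val (SubfieldElt Kx)) -(restrict_expg _ ss') -val_galgrpX.
by rewrite (exponent_dvd_expg K_exp).
Qed.

(** Transfers the action hypothesis to Aut(L): one exponent i describes t on mu_q and the conjugate
    of h by t on K. *)
Lemma target_conj t h : fixing F0 t -> fixing M h ->
  exists2 i : nat, (forall w, w ^+ q = 1 -> t w = w ^+ i) &
    forall x, x \in K -> t (h ((t^-1)%g x)) = (h ^+ i)%g x.
Proof.
move=> tF hM.
have [t' tt'] := galois_restrict L_alg (subfield_image_mem iota) KF tF.
have [h' hh'] := galois_restrict L_alg (cyclotomic_base p n iota) KM hM.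
have [|x Mx|g tg] := @restrict_aut L M F0 t _ _ tF.
- by move=> x; apply: cyclotomic_stable.
- exact: (cyclotomic_stable (fixingV tF) Mx).
exists (val (alpha g)) => [w wq|x Kx].
  have Mw := cyclotomic_mu iota wq.
  have e : val g (SubfieldElt Mw) = SubfieldElt Mw ^+ val (alpha g).
    by apply: alphaP; apply: val_inj; rewrite rmorphXn rmorph1.
  by have := congr1 val e; rewrite tg rmorphXn.
have tg' : restricts_to t' g by move=> y w yw; rewrite tt' tg yw.
have K1 : (t^-1)%g x \in K.
  exact: (galois_stable L_alg (subfield_image_mem iota) KF (fixingV tF) Kx).
set x1 : K := SubfieldElt K1.
have t1 : val (val t' x1) = x by rewrite tt' autVK.
have e : val t' (val h' x1) = (val h' ^+ val (alpha g))%g (val t' x1).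
  rewrite -(K_acts h' tg') -[RHS]/(val t' (val h' (((val t')^-1 * val t')%g x1))).
  by rewrite mulVg.
by have := congr1 val e; rewrite tt' hh' (restrict_expg _ hh') t1.
Qed.

(** Let h1 = t^-1 h t and h1 b = w b. Then h(t b) = t(w) t b = w^i t b, while h = t h1 t^-1 acts on
    K as h1^i, so h b = w^i b. The ratio is fixed by every h over M. *)
Lemma target_twist t b : fixing F0 t -> b \in K -> b != 0 -> b ^+ q \in M ->
  t b / b \in M.
Proof.
move=> tF Kb b0 Mb; apply: (galois_fixed L_alg (cyclotomic_base p n iota) KM).
  by apply: rpred_div => //; apply: (galois_stable L_alg (subfield_image_mem iota) KF tF Kb).
move=> h hM; pose h1 := (t^-1 * h * t)%g.
have h1E x : h1 x = (t^-1)%g (h (t x)) by [].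
have h1M : fixing M h1.
  by move=> x Mx; rewrite h1E hM ?autKV // (cyclotomic_stable tF Mx).
have [i ti hi] := target_conj tF h1M.
have [Mw wq] := kummer_char (@cyclotomic_mu p n F L iota) h1M b0 Mb.
set w := h1 b / b in Mw wq; have h1b : h1 b = w * b by rewrite divfK.
have h1X k : (h1 ^+ k)%g b = w ^+ k * b.
  elim: k => [|k IHk]; first by rewrite mul1r.
  by rewrite autXS IHk autfM autfX h1M // h1b mulrA -exprSr.
have hb : h b = w ^+ i * b.
  by rewrite -h1X -hi // h1E !autVK.
have htb : h (t b) = w ^+ i * t b.
  by rewrite -(ti w wq) -autfM -h1b h1E autVK.
rewrite fmorph_div /= htb hb -mulf_div divff ?mul1r //.
by rewrite expf_neq0 // mulf_neq0 ?invr_eq0 // fmorph_eq0.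
Qed.

(** For K containing F, having a q-th root in K depends only on the class, so one representative
    suffices. *)
Definition radical_classes : set (powquot F q) :=
  [set c | exists2 u : mulgrp F, c = powclass q u &
     exists2 b, b \in K & b ^+ q = iota (val u)]%classic.

Lemma radical_classes_group : group_closed (mem radical_classes).
Proof.
split; first by apply: mem_set; exists 1%g => //; exists 1; rewrite ?rpred1 ?expr1n ?rmorph1.
move=> x y /set_mem[u -> [b Kb bu]] /set_mem[v -> [c Kc cv]]; apply: mem_set.
exists (u * v^-1)%g.
  by rewrite -powquotME -powquotVE.
by exists (b / c); rewrite ?rpred_div // expr_div_n bu cv rmorphM fmorphV.
Qed.

(** A radical differs from an element of K by factors in F and mu_q. Conversely, elements of K are
    sums of b with b^q in M; [target_twist] and [cyclotomic_descent] give y in M with (b / y)^q in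
    F, so that b / y is a radical. *)
Lemma radical_ext_classes : radical_ext radical_classes = K.
Proof.
apply: subfield_eqP => x; apply/idP/idP => [|Kx].
  apply: subfield_gen_sub => b [/MK //|[u [v /eqP/powclassP[w Euv] [c Kc cv]] bu]].
  have Ebu : b ^+ q = (c * iota (val w)) ^+ q.
    have valX (i : nat) : val (w ^+ i)%g = val w ^+ i.
      by elim: i => // i IHi; rewrite expgS exprS -IHi.
    by rewrite bu Euv exprMn cv -rmorphXn -valX -rmorphM.
  have Kcw : c * iota (val w) \in K by rewrite rpredM // MK ?cyclotomic_base.
  have [e|cw0] := eqVneq (c * iota (val w)) 0.
    move: Ebu; rewrite e expr0n gtn_eqF // => /eqP.
    by rewrite expf_eq0 q_gt0 => /eqP->; apply: rpred0.
  rewrite -[b](divfK cw0) rpredM // MK // cyclotomic_mu //.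
  by rewrite expr_div_n Ebu divff // expf_neq0.
have [vs -> vsP] := kummer_generation L_alg z_prim (cyclotomic_base p n iota)
  (cyclotomic_zeta iota z_prim) KM target_abelian target_exponent Kx.
rewrite big_seq; apply: rpred_sum => b /vsP[Kb Mb].
have [->|b0] := eqVneq b 0; first exact: rpred0.
have [t [w [tF tz tgen]]] := cyclotomic_generator p_prime p_odd n_gt0 L_alg z_prim.
have [y [My y0 /asboolP[f fb]]] := cyclotomic_descent p_prime p_odd n_gt0 L_alg z_prim tF tz tgen
  b0 Mb (target_twist tF Kb b0 Mb).
have f0 : f != 0.
  by rewrite -(fmorph_eq0 iota) fb expf_neq0 // mulf_neq0 ?invr_eq0.
rewrite -[b](divfK y0) rpredM //; last exact: sub_radical_ext.
apply: radical_mem; exists (Mulgrp f0); last by rewrite fb.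
by exists (Mulgrp f0) => //; exists (b / y); rewrite // rpred_div // MK.
Qed.

End Surjectivity.
End Correspondence.

Theorem theorem1p13 (p n : nat) (p_prime : prime p) (p_odd : odd p)
    (n_gt0 : (0 < n)%N)
    (F : fieldType) (charF : p \notin [pchar F])
    (L : closedFieldType) (iota : {rmorphism F -> L})
    (L_alg : forall x : L, algebraicOver iota x) :
  let F0 := subfield_image iota in
  let M := cyclotomic_subfield iota (p ^ n) in
  forall (alpha : galgrp M F0 -> {unit 'Z_(p ^ n)}),
    is_cyclotomic_character alpha ->
  exists Phi : set (powquot F (p ^ n)) -> subfield L,
    set_bij
      [set U : set (powquot F (p ^ n)) | group_closed (mem U)]%classic
      [set K : subfield L |
        [/\ galois_ext K M, is_abelian (galgrp K M),
            exponent_dvd (galgrp K M) (p ^ n),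
            galois_ext K F0
          & acts_via K alpha]]%classic
      Phi.
Proof.
move=> F0 M alpha alphaP.
(* The characteristic is not p, which provides a primitive q-th root of unity in L. *)
have q0 : (p ^ n)%:R != 0 :> L.
  by rewrite natrX expf_neq0 // -(rmorph_nat iota) fmorph_eq0; move: charF; rewrite inE p_prime.
have [z z_prim] := closed_prim_root q0.
exists (radical_ext iota (n := n) (p := p)); split.
- move=> U /= U_group; split.
  + exact: (radical_ext_galoisM L_alg z_prim U_group).
  + exact: (radical_ext_abelian z_prim).
  + exact: (radical_ext_exponent iota z_prim).
  + exact: (radical_ext_galoisF L_alg z_prim U_group).
  + exact: (radical_ext_acts z_prim alphaP).
- move=> U V /set_mem U_group /set_mem V_group UV; apply/seteqP.
  have sub := radical_ext_sub p_prime p_odd n_gt0 L_alg z_prim.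
  by split; apply: sub => //; rewrite UV.
move=> K /= [KM Kab Kexp KF Kact]; exists (radical_classes iota K).
  exact: radical_classes_group.
exact: (radical_ext_classes p_prime p_odd n_gt0 L_alg z_prim alphaP).
Qed.
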